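(* For every finite set $S$ of finite strings over a finite alphabet, and for every tie-breaking rule, the superstring $\mathrm{GREEDY}(S)$ satisfies $|\mathrm{GREEDY}(S)| \le \frac{13+\sqrt{57}}{6}\cdot n$, where $n$ is the length of a shortest superstring of $S$. That is, the approximation ratio of GREEDY for the Shortest Superstring problem is at most $(13+\sqrt{57})/6 \approx 3.425$.
   Context: Shortest Superstring problem: given a finite set $S$ of strings, find a string of minimum length containing every string of $S$ as a (contiguous) substring; $n$ denotes this minimum length. For strings $s\neq t$, $\mathrm{ov}(s,t)$ is the longest suffix of $s$ that equals a prefix of $t$. The GREEDY algorithm: consider all ordered pairs $(s,t)$ of distinct strings of $S$ as directed edges, sorted in non-increasing order of $|\mathrm{ov}(s,t)|$ (ties broken arbitrarily); scan this list and select edge $(s,t)$ if no previously selected edge has tail $s$ or head $t$, and adding $(s,t)$ does not close a directed cycle with the selected edges. The selected edges form a directed Hamiltonian path $s_1\to s_2\to\dots\to s_m$, and GREEDY outputs the string obtained by merging consecutive strings with maximum overlap, i.e. $p_1p_2\cdots p_{m-1}s_m$ where $s_i=p_i\,\mathrm{ov}(s_i,s_{i+1})$. (Equivalently: GREEDY repeatedly merges two strings of maximum overlap until one string remains.)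
   Formalization: GREEDY is run on S after discarding every string that is a substring of another string of S (no change if S is factor-free); run literally on all factors of a word with L distinct letters, GREEDY outputs about L²/4 letters while n = L. *)

(* Defs.v *)
From HB Require Import structures.
From mathcomp Require Import all_boot all_order all_algebra.
From mathcomp Require Import finmap.

Set Implicit Arguments.
Unset Strict Implicit.
Unset Printing Implicit Defensive.

Import Order.TTheory GRing.Theory Num.Theory.

Definition superstring (A : finType) (S : {fset seq A}) (w : seq A) : Prop :=
  forall s, s \in S -> infix s w.

Definition shortest_superstring (A : finType) (S : {fset seq A}) (w : seq A)
    : Prop :=
  superstring S w /\ forall w', superstring S w' -> size w <= size w'.

(* On a set containing a string together with its substrings, the selection   *)
(* rule below has no constant approximation ratio: for the set of all         *)
(* nonempty factors of a word with L distinct letters it outputs a string of  *)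
(* length about L^2 / 4.  As is usual for this problem, strings occurring     *)
(* inside another string of S are therefore discarded first; this does not    *)
(* change the superstrings of S, and it is the identity on factor-free sets.  *)
Definition maximal_strings (A : finType) (S : {fset seq A}) : {fset seq A} :=
  [fset s in S | all (fun t => infix s t ==> (t == s)) (enum_fset S)]%fset.

Fixpoint ov (A : finType) (s t : seq A) : seq A :=
  if prefix s t then s else if s is _ :: s' then ov s' t else [::].

(* A tie-breaking rule is a choice of one such list. *)
Definition greedy_order (A : finType) (S : {fset seq A}) (E : seq (S * S))
    : Prop :=
  perm_eq E [seq e <- enum {: S * S} | e.1 != e.2] /\
  sorted (fun e f : S * S =>
            size (ov (val f.1) (val f.2)) <= size (ov (val e.1) (val e.2))) E.

(* The last conjunct: the edges F contain no directed path from e.2 to e.1. *)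
Definition selectable (A : finType) (S : {fset seq A}) (F : seq (S * S))
    (e : S * S) : bool :=
  [&& all (fun f => f.1 != e.1) F,
      all (fun f => f.2 != e.2) F
    & ~~ connect (fun u v => (u, v) \in F) e.2 e.1].

Definition greedy_edges (A : finType) (S : {fset seq A}) (E : seq (S * S))
    : seq (S * S) :=
  foldl (fun F e => if selectable F e then rcons F e else F) [::] E.

Fixpoint merge_from (A : finType) (s : seq A) (p : seq (seq A)) : seq A :=
  if p is t :: p' then take (size s - size (ov s t)) s ++ merge_from t p'
  else s.

Definition merge_path (A : finType) (p : seq (seq A)) : seq A :=
  if p is s :: p' then merge_from s p' else [::].

(* g is the output of GREEDY on S for some tie-breaking rule: p lists the     *)
(* vertices of the directed Hamiltonian path formed by the selected edges.    *)
Definition greedy_output (A : finType) (S : {fset seq A}) (g : seq A) : Prop :=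
  exists (E : seq (S * S)) (p : seq S),
    [/\ greedy_order E,
        perm_eq p (enum {: S}),
        sorted (fun u v => (u, v) \in greedy_edges E) p
      & g = merge_path (map val p)].

(* Main.v *)
Require Import Defs.
From HB Require Import structures.
From mathcomp Require Import all_boot all_order all_algebra.
From mathcomp Require Import finmap.
From mathcomp Require Import boolp zify lra.
From Stdlib Require Import Classical IndefiniteDescription.

Set Implicit Arguments.
Unset Strict Implicit.
Unset Printing Implicit Defensive.

Import Order.TTheory GRing.Theory Num.Theory.

(* Call an interval of the greedy path bad when its last string overlaps its
   first one by more than either link next to the interval: GREEDY rejected this
   overlap only because it would have closed a cycle.  The minimal bad intervals
   c, the culprits, are disjoint; closing one up with its overlap o_c gives a
   cyclic word, of length W_c.  Distribute the strings outside the culprits over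
   two classes, according to the side on which the weakest link around them
   lies.  On each class, enlarged by the culprits, an exchange argument for Monge
   weights compares the greedy overlaps with those in a shortest superstring;
   adding up, |GREEDY| + sum W_c <= 2n + sum o_c.  The same argument shows that
   sum W_c <= n and that the cyclic words are primitive and pairwise not
   conjugate.

   It remains to see that 26 sum o_c <= 26 n + 37 sum W_c.  Every culprit
   contains, for each rotation of its cyclic word, a string with a run of length
   o_c starting at that rotation.  For one or two strings chosen this way at the
   least and greatest rotations, or at a short factor which occurs once in a
   period, periodicity bounds the overlaps in the superstring with the chosen
   strings of other culprits, so that they take up enough room.  In all,
   |GREEDY| <= 89/26 n, and 89/26 < (13 + sqrt 57) / 6. *)

(** * Periodic words *)

(** The amount wanted from a culprit is [o - W - 11/26 W]: one period pays for the overlap of a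
    chosen string with the next one, and 11/26 of a period for a factor occurring once per period,
    because an overlap with a [q]-periodic word that starts with a unique factor of length [u] is
    shorter than [q + u]. The obstacle is that so short a unique factor need not exist. Then either
    two strings share the amount, or the run from an extremal rotation is itself the certificate.
    The latter gets expensive only if the run continues with another, small period, and long
    continuations at both extremal rotations produce a short unique factor again, at the break of
    one of them. Weights are scaled by 52 = 2 * 26, so 74 = 52 + 22 stands for 37/26 = 1 + 11/26.
    Substitution gives [26 |GREEDY| <= 78 n + 11 sum W <= 89 n]; 11/26 lies just below
    [(sqrt 57 - 5) / 6]. *)

Definition shift_eq (T : Type) (al : nat -> T) t s l :=
  forall k, k < l -> al (t + k) = al (t + s + k).

(* The factor of length u at t occurs only once in each period p of al. *)
Definition unrepeated (T : Type) (al : nat -> T) p t u :=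
  forall s, 0 < s < p -> ~ shift_eq al t s u.

(* The rotation at t is strictly the least of the p rotations for lt. *)
Definition least_rot (lt : rel nat) (al : nat -> nat) p t :=
  forall s, 0 < s < p ->
    exists l, shift_eq al t s l /\ lt (al (t + l)) (al (t + s + l)).

Definition primitive (T : Type) (al : nat -> T) p :=
  forall d, 0 < d < p -> ~ (forall t, al (t + d) = al t).

Section PeriodicSegment.
Variables (T : Type) (f : nat -> T).

(* A weak form of the theorem of Fine and Wilf: one instance of the
   period s2 - s1. *)
Lemma two_periods lo hi s1 s2 :
  0 < s1 -> 0 < s2 -> lo + s1 + s2 <= hi ->
  (forall u, lo <= u -> u + s1 < hi -> f u = f (u + s1)) ->
  (forall u, lo <= u -> u + s2 < hi -> f u = f (u + s2)) ->
  f (hi - s1) = f (hi - s2).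
Proof.
have [n le_n] := ubnP (s1 + s2); elim: n => // n IHn in hi s1 s2 le_n *.
have wl hi' s s' : s < s' -> s + s' < n.+1 -> 0 < s -> lo + s + s' <= hi' ->
  (forall u, lo <= u -> u + s < hi' -> f u = f (u + s)) ->
  (forall u, lo <= u -> u + s' < hi' -> f u = f (u + s')) ->
  f (hi' - s) = f (hi' - s').
  move=> lt_ss le_n' s_gt0 le_hi ps ps'.
  (* Subtractive Euclid: up to [hi' - s] the segment also has the period [s' - s]. *)
  have := IHn (hi' - s) s (s' - s).
  rewrite (_ : hi' - s - (s' - s) = hi' - s'); last by lia.
  move=> <-; try lia.
  - by rewrite [RHS]ps; try lia; congr f; lia.
  - by move=> u le_u ltu; apply: ps; lia.
  - move=> u le_u ltu; rewrite ps' //; last by lia.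
    by rewrite (ps (u + (s' - s))); try lia; congr f; lia.
move=> s1_gt0 s2_gt0 le_hi p1 p2; case: (ltngtP s1 s2) => [lt12|lt21|->] //.
  exact: wl.
by symmetry; apply: wl; rewrite // ?(addnC s2) // -addnA (addnC s2) addnA.
Qed.

End PeriodicSegment.

Section Periodic.
Variables (T : Type) (al : nat -> T) (p : nat).
Hypothesis per : forall t, al (t + p) = al t.

Lemma per_mul t k : al (t + k * p) = al t.
Proof. by elim: k => [|k IHk]; rewrite ?addn0 // mulSn addnCA addnC per. Qed.

Lemma per_mod t t' : t = t' %[mod p] -> al t = al t'.
Proof. by move=> e; rewrite (divn_eq t p) (divn_eq t' p) e addnC per_mul addnC per_mul. Qed.

Lemma shift_eq_mod t s t' s' l : t = t' %[mod p] -> t + s = t' + s' %[mod p] ->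
  shift_eq al t s l -> shift_eq al t' s' l.
Proof.
move=> e1 e2 m k /m; rewrite (per_mod (t := t + k) (t' := t' + k)).
  by move=> ->; apply: per_mod; rewrite -modnDml e2 modnDml.
by rewrite -modnDml e1 modnDml.
Qed.

Lemma unrepeated_mod t t' u : t = t' %[mod p] -> unrepeated al p t u -> unrepeated al p t' u.
Proof.
move=> e U s s0 m; apply: (U s s0); apply: shift_eq_mod m => //.
by rewrite -modnDml -e modnDml.
Qed.

Lemma shift_eq_period t s : 0 < p -> shift_eq al t s p -> forall u, al (u + s) = al u.
Proof.
move=> p0 m u; set k := (u + (p - t %% p)) %% p.
have e : t + k = u %[mod p].
  rewrite /k modnDmr -[RHS](modnMDl (t %/ p).+1); congr (_ %% _).
  by have := ltn_pmod t p0; have := divn_eq t p; nia.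
rewrite -(per_mod e) m ?ltn_pmod //; apply: per_mod.
by rewrite addnAC -[RHS]modnDml e modnDml.
Qed.

End Periodic.

Lemma least_rot_mod lt al p t t' : (forall u, al (u + p) = al u) ->
  t = t' %[mod p] -> least_rot lt al p t -> least_rot lt al p t'.
Proof.
move=> per e ly s /ly[l [m h]]; exists l; split.
  by apply: shift_eq_mod m => //; rewrite -modnDml e modnDml.
have E k : al (t + k) = al (t' + k).
  by apply: (per_mod per); rewrite -modnDml e modnDml.
by rewrite -addnA -!E addnA.
Qed.

Section TwoRuns.
Variables (lt : rel nat) (al : nat -> nat) (p i j d d' s1 l1 s2 l2 L : nat).
Hypothesis (ltnn : irreflexive lt) (ltT : transitive lt).
Hypothesis per : forall t, al (t + p) = al t.
Hypotheses (jE : j = i + d) (ipE : i + p = j + d').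
Hypotheses (s1_gt0 : 0 < s1) (s2_gt0 : 0 < s2).
Hypotheses (m1 : shift_eq al i s1 l1) (m2 : shift_eq al j s2 l2).
Hypothesis rise : lt (al (i + l1)) (al (i + s1 + l1)).
Hypothesis drop : lt (al (j + s2 + l2)) (al (j + l2)).
Hypotheses (l1d : l1 < d) (l2d : l2 < d') (Ll1 : L <= l1) (Ll2 : L <= l2).
Hypotheses (c1 : s1 + s2 + (d - l1) <= L) (c2 : s1 + s1 + (d' - l2) <= L).

(* The run of period s1 from i breaks upwards and the run of period s2 from
   j downwards; the factor made of the end of the first run and its breaking
   letter cannot be matched with the break of the second one. *)
Lemma two_runs : exists t, unrepeated al p t L.
Proof.
(* [e1] and [e2] are the breaking positions. The factor consists of the [L = x + 1] letters up to
   and including [e1]; [e'] is where a supposed second occurrence ends. *)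
pose e1 := i + l1 + s1; pose e2 := j + l2 + s2; pose x := L.-1.
exists (e1 - x) => s /andP[s0 sp] mF; pose e' := e1 + s.
have p1 u : i <= u -> u + s1 < e1 -> al u = al (u + s1).
  move=> iu ue; have := @m1 (u - i); rewrite /e1 in ue.
  rewrite (_ : i + (u - i) = u); last by lia.
  by rewrite (_ : i + s1 + (u - i) = u + s1); [apply; lia | lia].
have p2 u : j <= u -> u + s2 < e2 -> al u = al (u + s2).
  move=> iu ue; have := @m2 (u - j); rewrite /e2 in ue.
  rewrite (_ : j + (u - j) = u); last by lia.
  by rewrite (_ : j + s2 + (u - j) = u + s2); [apply; lia | lia].
have b1 : lt (al (e1 - s1)) (al e1).
  by move: rise; congr (lt (al _) (al _)); rewrite /e1; lia.
have b2 : lt (al e2) (al (e2 - s2)).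
  by move: drop; congr (lt (al _) (al _)); rewrite /e2; lia.
have F u : e1 - x <= u -> u <= e1 -> al u = al (u + s).
  move=> h1 h2; have := mF (u - (e1 - x)).
  rewrite (_ : e1 - x + (u - (e1 - x)) = u); last by lia.
  rewrite (_ : e1 - x + s + (u - (e1 - x)) = u + s); last by lia.
  by apply; lia.
have pF u : e' - x <= u -> u + s1 < e' -> al u = al (u + s1).
  move=> h1 h2; rewrite /e' /e1 in h1 h2; have := p1 (u - s).
  have := F (u - s); have := F (u - s + s1).
  rewrite (_ : u - s + s1 + s = u + s1); last by lia.
  rewrite (_ : u - s + s = u); last by lia.
  by move=> <-; [move=> <- //; rewrite /e1; lia | rewrite /e1; lia ..].
have bF : lt (al (e' - s1)) (al e').
  rewrite /e' -(F e1); try by rewrite /e1; lia.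
  by rewrite -addnBAC -?F // /e1; lia.
have irr a b : lt a b -> a = b -> False by move=> h ab; rewrite ab ltnn in h.
(* Four positions of [e']: soon after [e1] the occurrence contains the break at [e1]; within the
   second run the periods [s1] and [s2] share a long segment; a little further it contains the break
   at [e2]; beyond that it ends inside the next copy of the first run. *)
have [le_e|gt_e] := leqP e' e2.
- have [far|near] := leqP (j + s1 + s2) e'; last first.
    have [in1|out1] := leqP (e' - x) (e1 - s1).
      apply: (irr _ _ b1); rewrite (pF (e1 - s1)) //; rewrite /e' /e1; try lia.
      by congr al; lia.
    by rewrite /e' /e1 /x in near out1; lia.
  have h : al (e' - s1) = al (e' - s2).
    apply: (@two_periods _ al (maxn j (e' - x))) => //.
    - by rewrite /e' /e1 /x in far *; lia.
    - by move=> u; rewrite geq_max => /andP[_ h]; apply: pF.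
    - by move=> u; rewrite geq_max => /andP[h _] ?; apply: p2 => //; lia.
  case: (ltngtP e' e2) le_e => // [lt_e|ee] _.
    apply: (irr _ _ bF); rewrite h (p2 (e' - s2)); last first.
    - by lia. - by lia.
    by congr al; lia.
  by apply: (irr _ _ (ltT b2 _) erefl); rewrite -ee -h.
have h : e' - x + s1 + s2 <= e2 -> False.
  move=> le_lo; have h : al (e2 - s1) = al (e2 - s2).
    apply: (@two_periods _ al (maxn j (e' - x))) => //.
    - by rewrite /e2 in le_lo *; lia.
    - by move=> u; rewrite geq_max => /andP[_ h] ?; apply: pF => //; lia.
    - by move=> u; rewrite geq_max => /andP[h _]; apply: p2.
  apply: (irr _ _ b2); rewrite -h [RHS](pF (e2 - s1)); last 2 first.
  - by lia. - by lia.
  by congr al; lia.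
have [near|far] := leqP (i + p + s1) e'.
  apply: (irr _ _ bF); have := p1 (e' - s1 - p).
  rewrite -(per (e' - s1 - p)) -(per (e' - s1 - p + s1)).
  rewrite (_ : _ - _ - p + p = e' - s1); last by lia.
  rewrite (_ : _ + s1 + p = e'); last by lia.
  by apply; rewrite /e' in near *; lia.
by apply: h; rewrite /e' /e1 /e2 /x in far *; lia.
Qed.

End TwoRuns.

Section PlainOverlap.
Variables (T : Type) (al be : nat -> T) (p q : nat).
Hypotheses (p_gt0 : 0 < p) (q_gt0 : 0 < q).
Hypotheses (pal : forall t, al (t + p) = al t) (pbe : forall t, be (t + q) = be t).

(* The cyclic words of al and be are not conjugate. *)
Definition inequiv := p = q -> forall r, ~ (forall t, be t = al (t + r)).

(** [r * q.-1] is [- r] modulo [q], written without subtraction. *)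
Lemma common_factor t r : p %| q ->
  (forall k, k < q -> al (t + k) = be (r + k)) ->
  forall s, be s = al (s + (t + r * q.-1)).
Proof.
move=> dv fac s; have all x : be (r + x) = al (t + x).
  rewrite -(per_mod pbe (t := r + x %% q)); last by rewrite modnDmr.
  rewrite -fac ?ltn_pmod //.
  by apply: (per_mod pal); rewrite -modnDmr modn_dvdm // modnDmr.
rewrite -(per_mul pbe s r) (_ : s + r * q = r + (s + r * q.-1)).
  by rewrite all; congr al; lia.
by case: q q_gt0 => // q' _; rewrite mulnS; lia.
Qed.

(** An overlap of [q + u] letters would repeat the factor at distance [q], so [p] divides [q] and
    [be] is a rotation of [al]. For [p < q] this contradicts the primitivity of [be], for [p = q] it
    contradicts [inequiv]. *)
Lemma plain_overlap t r y u : primitive be q -> inequiv ->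
  unrepeated al p t u -> (forall k, k < y -> al (t + k) = be (r + k)) -> y < q + u.
Proof.
move=> prim neq U fac; rewrite ltnNge; apply/negP => le_y.
have mq : shift_eq al t q u.
  move=> k ku; rewrite fac; last by lia.
  rewrite -addnA fac; last by lia.
  by rewrite -(pbe (r + k)); congr be; lia.
have [dv|ndv] := boolP (p %| q); last first.
  apply: (U (q %% p)).
    by rewrite ltn_mod p_gt0 lt0n -/(dvdn _ _) ndv.
  by apply: (shift_eq_mod pal) mq => //; rewrite modnDmr.
have rE := common_factor dv (fun k kq => fac k (leq_trans kq (leq_trans (leq_addr u q) le_y))).
have [lt_pq|le_qp] := ltnP p q; last first.
  by apply: (neq _ (t + r * q.-1)) => //; have := dvdn_leq q_gt0 dv; lia.
by apply: (prim p) => [|s]; [lia | rewrite !rE addnAC pal].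
Qed.

End PlainOverlap.

(** * Extremal rotations: unique factors, borders, alignment *)

Section Lyndon.
Variable lt : rel nat.
Hypotheses (ltnn : irreflexive lt) (ltT : transitive lt).

Let asym a b : lt a b -> lt b a -> False.
Proof. by move=> h /(ltT h); rewrite ltnn. Qed.

(** If the factor recurred at distance [s], the rotations at [i] and [i + s] would first differ
    beyond it, at the same letter as those at [i + d] and [i + d + s]. The two extremal properties
    give opposite verdicts there. *)
Lemma least_rot_unrepeated al p i d :
  least_rot lt al p i -> least_rot (fun a b => lt b a) al p (i + d) -> unrepeated al p i d.
Proof.
move=> li lj s s0 m; have [l [ml hl]] := li s s0; have [l' [ml' hl']] := lj s s0.
have [ld|dl] := ltnP l d; first by rewrite m ?ltnn in hl.
have e k : i + d + s + k = i + s + (d + k) by lia.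
have e' k : i + d + k = i + (d + k) by lia.
rewrite e e' in hl'; case: (ltngtP (d + l') l) => [lt_l|gt_l|eq_l].
- by rewrite ml ?ltnn in hl'.
- have := ml' (l - d); rewrite e e' subnKC // => h; rewrite h ?ltnn in hl => //; lia.
- by rewrite eq_l in hl'; apply: asym hl hl'.
Qed.

(** A Lyndon word has no border: after a border of length [p - q], the comparison with the shift [q]
    continues as the comparison with the shift [p - q], with its sides exchanged. *)
Lemma least_rot_unbordered al p i q : (forall t, al (t + p) = al t) ->
  least_rot lt al p i -> 0 < q < p -> ~ shift_eq al i q (p - q).
Proof.
move=> per li qp m; have [l [ml hl]] := li q qp.
have [l2 [ml2 hl2]] := li (p - q) ltac:(lia).
have [ld|dl] := ltnP l (p - q); first by rewrite m ?ltnn in hl.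
have e k : i + q + (p - q + k) = i + k + p by lia.
have e' k : i + (p - q) + k = i + (p - q + k) by lia.
rewrite e' in hl2; case: (ltngtP (p - q + l2) l) => [lt_l|gt_l|eq_l].
- by rewrite (ml (p - q + l2)) // e per ltnn in hl2.
- have := ml2 (l - (p - q)); rewrite e' subnKC // => h.
  have := e (l - (p - q)); rewrite subnKC // => e1; rewrite e1 per h ?ltnn in hl => //; lia.
- by have := e l2; rewrite eq_l => e1; rewrite e1 per -eq_l in hl; apply: asym hl hl2.
Qed.

(* An overlap long enough to see a shorter period q twice forces the minimal
   rotation of the q-periodic word to start where the overlap starts; otherwise
   the q-periodic word itself carries a long run of a small period. *)
Lemma least_rot_align al p be q t r i' e : 0 < q < p ->
  (forall s, be (s + q) = be s) -> primitive be q ->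
  least_rot lt al p t -> least_rot lt be q i' ->
  (forall k, k < q + e -> al (t + k) = be (r + k)) ->
  r = i' %[mod q] \/ forall v, unrepeated be q i' v -> e < v.
Proof.
move=> qp per prim lt_t li fac; have q0 : 0 < q by lia.
pose k0 := (i' + (q - r %% q)) %% q.
have k0q : k0 < q by rewrite ltn_pmod.
have rk0 : r + k0 = i' %[mod q].
  rewrite /k0 modnDmr -[RHS](modnMDl (r %/ q).+1); congr (_ %% _).
  by have := ltn_pmod r q0; have := divn_eq r q; nia.
have [k00|k0_gt0] := posnP k0; first by left; rewrite -rk0 k00 addn0.
have bk k : be (i' + k) = be (r + k0 + k).
  by apply: (per_mod per); rewrite -modnDml -rk0 modnDml.
right; have [l [ml hl]] := lt_t k0 ltac:(lia).
(* Leastness of [t] compares [r] with [r + k0], leastness of [i'] compares them the other way round.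
   The verdicts are compatible only if the first one falls after the overlap. *)
have ge_l : q + e <= k0 + l.
  rewrite leqNgt; apply/negP => lt_l.
  have [l' [ml' hl']] := li (q - k0) ltac:(lia).
  have e1 k : be (i' + (q - k0) + k) = be (r + k).
    by rewrite -addnA bk -(per (r + k)); congr be; lia.
  have m1 k : k < l -> be (r + k) = be (r + k0 + k).
    by move=> kl; have := ml k kl; rewrite fac -?addnA ?fac ?addnA //; lia.
  have m2 k : k < l' -> be (r + k0 + k) = be (r + k).
    by move=> /ml'; rewrite bk e1.
  rewrite bk e1 in hl'; rewrite fac -?addnA ?fac ?addnA in hl; try lia.
  case: (ltngtP l l') => [ll|ll|ll].
  - by rewrite -m2 // ltnn in hl.
  - by rewrite -m1 // ltnn in hl'.
  - by rewrite ll in hl; apply: asym hl hl'.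
have m1 k : k < q + e - k0 -> be (r + k) = be (r + k0 + k).
  by move=> kl; have := ml k; rewrite fac -?addnA ?fac ?addnA; try lia; apply; lia.
(* The agreement of length [q + e - k0] is a whole period if [k0 <= e]; otherwise it makes the
   factor of length [e] at [i'] recur at distance [q - k0]. *)
have [le_k|lt_k] := leqP k0 e.
  case: (prim k0); first by lia.
  by apply: (shift_eq_period per (t := r)) => // k kq; apply: m1; lia.
move=> v U; rewrite ltnNge; apply/negP => le_v.
apply: (U (q - k0)); first by lia.
move=> k kv; rewrite bk -m1; last by lia.
rewrite -addnA bk -(per (r + k)); congr be; lia.
Qed.

End Lyndon.

Lemma least_rot_exists (lt : rel nat) al p : irreflexive lt -> transitive lt ->
  (forall a b, a != b -> lt a b || lt b a) ->
  0 < p -> (forall t, al (t + p) = al t) -> primitive al p ->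
  exists2 i, i < p & least_rot lt al p i.
Proof.
move=> ltnn ltT ltV p0 per prim.
pose lx r r' := exists l, (forall k, k < l -> al (r + k) = al (r' + k)) /\
                          lt (al (r + l)) (al (r' + l)).
have lxT a b c : lx a b -> lx b c -> lx a c.
  move=> [l [m h]] [l' [m' h']]; case: (ltngtP l l') => [ll|ll|ll].
  - by exists l; split=> [k kl|]; [rewrite m // m' // (ltn_trans kl) | rewrite -m'].
  - by exists l'; split=> [k kl|]; [rewrite m ?m' // (ltn_trans kl) | rewrite m].
  - exists l; split=> [k kl|]; first by rewrite m // m' // -ll.
    by apply: ltT h _; rewrite ll.
have lxV r r' : r < r' -> r' < p -> lx r r' \/ lx r' r.
  move=> rr rp; have : exists k, al (r + k) != al (r' + k).
    apply: NNPP => h; case: (prim (r' - r)); first by lia.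
    apply: (shift_eq_period per (t := r)) => // k _; apply/eqP; apply: NNPP => hk.
    by apply: h; exists k; move/negP: hk; rewrite subnKC // ltnW.
  move=> /ex_minnP[l hl hmin].
  have m k : k < l -> al (r + k) = al (r' + k).
    by move=> kl; apply/eqP; apply: contraLR kl => /hmin; rewrite -leqNgt.
  by case/orP: (ltV _ _ hl) => h; [left | right]; exists l; split=> // k /m.
have [m le_m m0] : exists2 m, p <= m & 0 < m by exists p.
suff [i ip h] : exists2 i, i < p & forall j, j < m -> j < p -> j != i -> lx i j.
  exists i => // s s0; have sp : (i + s) %% p < p by rewrite ltn_pmod.
  have ne : (i + s) %% p != i.
    apply/eqP => e; have := divn_eq (i + s) p; rewrite e;
    by case: (_ %/ _) => [|k]; rewrite ?mulSn; lia.
  have [|l [ml hl]] := h _ _ sp ne; first by lia.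
  have E k : al ((i + s) %% p + k) = al (i + s + k).
    by apply: (per_mod per); rewrite modnDml.
  by exists l; split=> [k /ml|]; rewrite -E.
elim: m m0 {le_m} => // m IHm _; case: m IHm => [_|m IHm].
  by exists 0 => // j; rewrite ltnS leqn0 => /eqP->.
have [i ip h] := IHm isT; have [le_p|lt_p] := leqP p m.+1.
  by exists i => // j _ jp; apply: h => //; lia.
have [mi|ne] := eqVneq m.+1 i.
  exists i => // j; rewrite ltnS leq_eqVlt => /orP[/eqP-> _|].
    by rewrite mi eqxx.
  exact: h.
have [mi|im] : lx m.+1 i \/ lx i m.+1.
  by case: (ltngtP m.+1 i) ne => // l _; [apply: lxV | case: (lxV _ _ l lt_p); tauto].
- exists m.+1 => // j; rewrite ltnS leq_eqVlt => /orP[/eqP->|jm jp nj].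
    by rewrite eqxx.
  have [->|ji] := eqVneq j i; first by [].
  by apply: lxT mi _; apply: h.
- exists i => // j; rewrite ltnS leq_eqVlt => /orP[/eqP->|] //.
  exact: h.
Qed.

(** * Charging the strings of a superstring *)

Lemma ltn_irr : irreflexive ltn. Proof. exact: ltnn. Qed.
Lemma gtn_irr : irreflexive gtn. Proof. exact: ltnn. Qed.
Lemma ltn_tr : transitive ltn. Proof. exact: ltn_trans. Qed.
Lemma gtn_tr : transitive gtn. Proof. by move=> a b c /= h1 h2; apply: ltn_trans h2 h1. Qed.

Section Charging.
(* The cyclic word al c of the culprit c has period W c and closing overlap o c;
   its least and greatest rotations start at i0 c and i0 c + d c.  The string i
   occupies len i letters of the superstring T from pos i on, and reads al c from
   index ph i on. *)
Variables (C : finType) (I : eqType) (W o i0 d : C -> nat) (al : C -> nat -> nat).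
Variables (mem : C -> pred I) (pos len ph : I -> nat) (T : nat -> nat).
Hypothesis W_gt0 : forall c, 0 < W c.
Hypothesis perW : forall c t, al c (t + W c) = al c t.
Hypothesis primW : forall c, primitive (al c) (W c).
Hypothesis neqW : forall c c', c != c' -> inequiv (al c) (al c') (W c) (W c').
Hypothesis minW : forall c, least_rot ltn (al c) (W c) (i0 c).
Hypothesis maxW : forall c, least_rot gtn (al c) (W c) (i0 c + d c).
Hypothesis dW : forall c, d c < W c.
Hypothesis occ : forall c i x, mem c i -> x < len i -> T (pos i + x) = al c (ph i + x).
Hypothesis cover : forall c t, exists i, [/\ mem c i &
  exists A, [/\ pos i <= A, A + o c <= pos i + len i &
                ph i + (A - pos i) = t %[mod W c]]].

Local Notation fin i := (pos i + len i).

(* The two critical rotations, the minimal (false) and the maximal (true) one,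
   and the distance from each of them to the next occurrence of the other. *)
Definition crit c (b : bool) := if b then i0 c + d c else i0 c.
Definition gap c (b : bool) := if b then W c - d c else d c.

Lemma gapN c b : gap c b + gap c (~~ b) = W c.
Proof. by have := dW c; case: b => /=; lia. Qed.

Lemma gap_leW c b : gap c b <= W c.
Proof. by rewrite -(gapN c b) leq_addr. Qed.

Lemma critN c b : crit c b + gap c b = crit c (~~ b) %[mod W c].
Proof.
case: b => //=; rewrite -addnA subnKC; last exact: ltnW.
by rewrite modnDr.
Qed.

Definition olt (b : bool) : rel nat := if b then gtn else ltn.

Lemma least_rot_crit c b : least_rot (olt b) (al c) (W c) (crit c b).
Proof. by case: b; [apply: maxW | apply: minW]. Qed.

Lemma olt_irr b : irreflexive (olt b).
Proof. by case: b; [apply: gtn_irr | apply: ltn_irr]. Qed.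

Lemma olt_tr b : transitive (olt b).
Proof. by case: b; [apply: gtn_tr | apply: ltn_tr]. Qed.

Lemma unrepeated_crit c b : unrepeated (al c) (W c) (crit c b) (gap c b).
Proof.
apply: (least_rot_unrepeated (lt := olt b) (@olt_irr b) (@olt_tr b)); first exact: least_rot_crit.
have h := @least_rot_crit c (~~ b); have e : forall x y, olt b y x = olt (~~ b) x y by case: b h.
have /(least_rot_mod (@perW c) (esym (critN c b))) l := h.
by move=> s /l[k [m hk]]; exists k; rewrite e.
Qed.

(* The index in [al c] of position P of T, read inside the occurrence of i. *)
Definition phase i P := ph i + (P - pos i).

Lemma occ_phase c i P k : mem c i -> pos i <= P -> P + k < fin i ->
  T (P + k) = al c (phase i P + k).
Proof.
move=> ci le_P lt_P; have := occ (x := P - pos i + k) ci.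
rewrite /phase addnA subnKC // => ->; first by rewrite addnA.
by lia.
Qed.

Lemma phaseD i P k : pos i <= P -> phase i (P + k) = phase i P + k.
Proof. by move=> h; rewrite /phase; lia. Qed.

Definition at_crit c b i P := phase i P = crit c b %[mod W c].

(* K / 52 bounds how far a run of length at most o c from the critical rotation
   can be continued with another period s, up to a discount 22 s / 52. *)
Definition good c b K := forall s l, 0 < s < W c -> shift_eq (al c) (crit c b) s l ->
  52 * l <= K + 22 * s /\ (l + W c + s <= o c -> 52 * l <= K).

(** The range in which [select_ex] needs values of the second kind. In units of 1/26 of a period, 41
    = (22 + 38 + 22) / 2 is the largest closing overlap for which [strong_big] balances. *)
Definition big_gaps c := [/\ forall b, 22 * W c < 52 * gap c b,
  26 * o c < 41 * W c & 37 * W c < 26 * o c].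

(* A value v of a string i of c certifies that a string i' of another culprit c',
   if it starts before i, ends at least v / 52 - W c' before the end of i; the
   certificate is a factor of i occurring once per period, or a run of length o c
   from a critical rotation.  The exception, for the second kind only, is that i'
   is hard; see overlap_cost. *)
Definition value_unique c i (v : int) := exists P u, [/\ pos i <= P,
  unrepeated (al c) (W c) (phase i P) u &
  v = (52%:Z * ((fin i)%:Z - P%:Z - u%:Z))%R].

Definition value_good c i (v : int) := exists P b K, [/\ pos i <= P,
  P + o c <= fin i, at_crit c b i P, good c b K &
  [/\ big_gaps c, 22 * W c <= K & v = (52%:Z * (o c)%:Z - K%:Z)%R]].

Definition value c i v := value_unique c i v \/ value_good c i v.

(** The configuration in which the overlap costs more than [W c]: [e] is its excess over the shorter
    period [W c], [p] is the longer period, that of the other culprit, and the final disjunction is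
    the alternative of [least_rot_align]. *)
Definition hard c i P e p := [/\ pos i <= P, P + W c + e = fin i, e + W c < p &
  [/\ 11 * p < 26 * e, 26 * e < 15 * p &
  (exists b, gap c b + e < W c) \/ (exists b, at_crit c b i P)]].

Lemma overlap_cost c c' i i' v : c != c' -> mem c i -> mem c' i' ->
  pos i' < pos i -> fin i' < fin i -> value c i v ->
  (v <= 52%:Z * (W c')%:Z + 52%:Z * ((fin i)%:Z - (fin i')%:Z))%R \/
  exists P e p, hard c' i' P e p /\
   (v <= 52%:Z * (W c')%:Z + 52%:Z * ((fin i)%:Z - (fin i')%:Z) +
         Num.min (52%:Z * e%:Z - 22%:Z * p%:Z) (22%:Z * (W c')%:Z))%R.
Proof.
move=> cc ci ci' lt_p lt_f; set q := W c'.
have q0 : 0 < q by apply: W_gt0.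
have fac P k : pos i <= P -> k < fin i' - P ->
    al c (phase i P + k) = al c' (phase i' P + k).
  by move=> le_P lt_k; rewrite -(occ_phase ci) -?(occ_phase ci') //; lia.
case=> [[P [u [le_P U ->]]]|[P [b [K [le_P le_o phE gK [[g1 g2 g3] KW ->]]]]]].
  left; have := plain_overlap (W_gt0 c) (W_gt0 c') (perW c) (perW c')
    (@primW c') (neqW cc) U (fun k => @fac P k le_P).
  by rewrite -/q; lia.
set p := W c in g1 g2 g3 KW *; pose y := fin i' - P.
have p0 : 0 < p by apply: W_gt0.
have [small|large] := leqP (52 * minn y (o c)) (52 * q + K).
  by left; move: small; rewrite /y; lia.
have yE : P + y = fin i' by rewrite /y; lia.
have mt l : q + l <= y -> shift_eq (al c) (crit c b) q l.
  move=> le_l; apply: (shift_eq_mod (perW c) (t := phase i P) (s := q)) => //.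
    by rewrite -modnDml phE modnDml.
  move=> k kl; rewrite -addnA !fac; try lia.
  by rewrite (addnCA _ q) [q + _]addnC; symmetry; apply: perW.
have [lt_qp|lt_pq|eq_pq] := ltngtP q p; last 1 first.
- case: (neqW cc (esym eq_pq) (r := phase i P + phase i' P * q.-1)) => s.
  apply: (common_factor p0 q0 (perW c) (perW c')) => [|k kq].
    by rewrite -/p -eq_pq.
  by apply: fac; lia.
(* An overlap of [p] letters would give a border to the word read from an extremal rotation. *)
- have y_ltp : y < p.
    rewrite ltnNge; apply/negP => le_py.
    apply: (least_rot_unbordered (@olt_irr b) (@olt_tr b) (perW c) (@least_rot_crit c b) (q := q)).
      by rewrite q0.
    by apply: mt; rewrite /p in lt_qp le_py *; lia.
  pose e := y - q; have yqe : y = q + e by rewrite /e; lia.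
  have [||h1 _] := gK q e.
  - by rewrite q0.
  - by apply: mt; rewrite yqe.
  have e_gap : e < gap c b.
    rewrite ltnNge; apply/negP => le_g; apply: (@unrepeated_crit c b q); first by rewrite q0.
    by apply: mt; rewrite yqe leq_add2l.
  (* [11 p < 26 e] comes from [large] and [22 p <= K]; [26 e < 15 p] from [e < gap c b], since the
     other gap exceeds [22 p / 52]. *)
  have gN := gapN c b; have gb := g1 (~~ b); rewrite -/p in gN.
  right; exists P, e, p; split; last by lia.
  split; [lia | lia | lia | split; [lia | lia |]].
  have al_t : least_rot (olt b) (al c) p (phase i P).
    by apply: (least_rot_mod (perW c) (esym phE)); apply: least_rot_crit.
  have qp : 0 < q < p by rewrite q0.
  have fac_e k : k < q + e -> al c (phase i P + k) = al c' (phase i' P + k).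
    by rewrite -yqe; apply: fac.
  have [r_al|r_un] := least_rot_align (@olt_irr b) (@olt_tr b) qp (perW c')
    (@primW c') al_t (@least_rot_crit c' b) fac_e.
  + by right; exists b.
  + left; exists (~~ b); have := r_un _ (@unrepeated_crit c' b).
    by have := gapN c' b; rewrite -/q; lia.
(* As [al c] has period [p], the overlap contains a run for the shift [q - p]. Its length satisfies
   the premise of the second clause of [good], whose conclusion contradicts [large]. *)
- have [||_ h] := gK (q - p) (minn y (o c) - q).
  + by rewrite -/p; lia.
  + apply: (shift_eq_mod (perW c) (t := crit c b) (s := q)) => //; last by apply: mt; lia.
    by rewrite -/p -[in LHS](subnK (ltnW lt_pq)) addnA modnDr.
  + by left; have := h; rewrite -/p; lia.
Qed.

Lemma neq_negb (b b' : bool) : b != b' -> b = ~~ b'.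
Proof. by case: b; case: b'. Qed.

(* The string i can pay R, whatever value the next chosen string has. *)
Definition strong c i (R : int) := [/\ mem c i,
  exists2 v, value c i v & (R + 52%:Z * (W c)%:Z <= v)%R &
  forall P e p, hard c i P e p -> exists2 v, value c i v &
   (R + 52%:Z * (W c)%:Z +
    Num.min (52%:Z * e%:Z - 22%:Z * p%:Z) (22%:Z * (W c)%:Z) <= v)%R].

Lemma charge_step c c' i i' v R : c != c' -> strong c' i' R -> mem c i ->
  pos i' < pos i -> fin i' < fin i -> value c i v ->
  exists2 v', value c' i' v' &
    (v + R <= v' + 52%:Z * ((fin i)%:Z - (fin i')%:Z))%R.
Proof.
move=> cc [mi' [v0 v0v le_v0] h] mi lt_p lt_f iv.
have [le_v|[P [e [p [hP le_v]]]]] := overlap_cost cc mi mi' lt_p lt_f iv.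
  by exists v0 => //; lia.
by have [v1 v1v le_v1] := h _ _ _ hP; exists v1 => //; lia.
Qed.

Lemma charge_weak c c' i i' v : c != c' -> mem c i -> mem c' i' ->
  pos i' < pos i -> fin i' < fin i -> value c i v ->
  (v <= 74%:Z * (W c')%:Z + 52%:Z * ((fin i)%:Z - (fin i')%:Z))%R.
Proof.
move=> cc mi mi' lt_p lt_f iv.
have [|[P [e [p [hP le_v]]]]] := overlap_cost cc mi mi' lt_p lt_f iv; lia.
Qed.

Definition window c b i := exists A, [/\ pos i <= A, A + o c <= fin i &
  at_crit c b i A].

(** If the least and the greatest rotation coincide, [P = Q] is possible although one gap is a full
    period; the last premise excludes this. *)
Lemma next_crit c b i P Q : pos i <= P -> P <= Q ->
  at_crit c b i P -> at_crit c (~~ b) i Q ->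
  P < Q \/ 0 < gap c (~~ b) -> P + gap c b <= Q.
Proof.
move=> le_P le_PQ eP eQ h; have gN := gapN c b.
have /eqP : (Q - P) = gap c b %[mod W c].
  apply/eqP; rewrite -(eqn_modDl (crit c b)) critN -eQ -modnDml -eP modnDml.
  by rewrite -phaseD // subnKC.
have [lt_g|ge_g] := ltnP (gap c b) (W c).
  rewrite (modn_small lt_g) => /eqP e; have : gap c b <= Q - P by rewrite -e leq_mod.
  by clear - le_PQ; lia.
have -> : gap c b = W c by clear - ge_g gN; lia.
rewrite modnn -/(dvdn _ _) => dv; have lt_PQ : P < Q by clear - h ge_g gN; lia.
have : W c <= Q - P by apply: dvdn_leq dv; rewrite subn_gt0.
by clear - le_PQ; lia.
Qed.

Lemma value_crit c b i P : pos i <= P -> at_crit c b i P ->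
  value c i (52%:Z * ((fin i)%:Z - P%:Z - (gap c b)%:Z))%R.
Proof.
move=> le_P e; left; exists P, (gap c b); split=> //.
by apply: (unrepeated_mod (perW c) (esym e)); apply: unrepeated_crit.
Qed.

(** The factor from the earlier critical position to the later one is unrepeated, and [o c] letters
    of the string follow its end. *)
Lemma both_windows c i : window c false i -> window c true i ->
  exists2 v, value c i v & (52%:Z * (o c)%:Z <= v)%R.
Proof.
move=> [A [A1 A2 A3]] [B [B1 B2 B3]].
wlog [b [X [Y [X1 Y2 X3 XY]]]] : / exists b X Y, [/\ pos i <= X, Y + o c <= fin i,
    at_crit c b i X & X + gap c b <= Y].
  apply; have [le_AB|lt_BA] := leqP A B; last first.
    exists true, B, A; split=> //; apply: next_crit B3 A3 _ => //; first exact: ltnW.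
    by left.
  exists false, A, B; split=> //; apply: next_crit A3 B3 _ => //.
  by right; rewrite /= subn_gt0.
by exists (52%:Z * ((fin i)%:Z - X%:Z - (gap c b)%:Z))%R; [apply: value_crit | lia].
Qed.

Lemma in_phase c i i' P Q : mem c i -> mem c i' -> pos i' < pos i ->
  fin i' < fin i -> pos i <= P -> P + W c <= fin i' -> pos i <= Q ->
  phase i Q = phase i' Q %[mod W c].
Proof.
move=> mi mi' lt_p lt_f le_P le_PW le_Q.
have e : phase i P = phase i' P %[mod W c].
  set r := phase i P; set r' := phase i' P; set s := (r' + (W c - r %% W c)) %% W c.
  have rs : r + s = r' %[mod W c].
    rewrite /s modnDmr -[RHS](modnMDl (r %/ W c).+1); congr (_ %% _).
    by have := ltn_pmod r (W_gt0 c); have := divn_eq r (W c); nia.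
  have [s0|s_gt0] := posnP s; first by rewrite -rs s0 addn0.
  case: (@primW c s); first by rewrite s_gt0 ltn_pmod.
  apply: (shift_eq_period (perW c) (W_gt0 c) (t := r)) => k kW.
  have lt_k : P + k < fin i' by rewrite (leq_trans _ le_PW) // ltn_add2l.
  have le_P' : pos i' <= P by rewrite (leq_trans (ltnW lt_p)).
  rewrite -(occ_phase mi le_P (ltn_trans lt_k lt_f)) (occ_phase mi' le_P' lt_k).
  by apply: (per_mod (perW c)); rewrite -modnDml -rs modnDml.
apply/eqP; rewrite -(eqn_modDr (P - pos i)).
have -> : phase i Q + (P - pos i) = phase i P + (Q - pos i).
  by rewrite /phase addnAC.
have -> : phase i' Q + (P - pos i) = phase i' P + (Q - pos i).
  by rewrite /phase; clear - lt_p le_P le_Q; lia.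
by rewrite eqn_modDr; apply/eqP.
Qed.

(** If the certificate of [i] meets [i'] in less than a period, the period reserved in [strong] is
    enough. Otherwise the two strings are in phase, the critical position in [i] continues the
    reading of [i'], and the factor of [i'] between the two critical positions pays for both
    strings. *)
Lemma charge_merge c b i i' v R : strong c i' R -> mem c i ->
  0 < d c -> window c b i' -> window c (~~ b) i ->
  pos i' < pos i -> fin i' < fin i -> value c i v ->
  (exists2 v', value c i' v' &
     (v + R <= v' + 52%:Z * ((fin i)%:Z - (fin i')%:Z))%R) \/
  (exists2 v', value c i' v' &
     (52%:Z * (o c)%:Z <= v' + 52%:Z * ((fin i)%:Z - (fin i')%:Z))%R).
Proof.
move=> [mi' [v0 v0v le_v0] _] mi d_gt0 [A' [A1 A2 A3]] [A [B1 B2 B3]] lt_p lt_f iv.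
have [P [le_P le_v]] : exists P, pos i <= P /\ (v <= 52%:Z * ((fin i)%:Z - P%:Z))%R.
  case: iv => [[P [u [le_P _ ->]]]|[P [b' [K [le_P le_f _ _ [_ _ ->]]]]]].
  - by exists P; split=> //; lia.
  - by exists P; split=> //; lia.
have [near|far] := leqP (P + W c) (fin i'); last by left; exists v0 => //; lia.
right; have sync Q : pos i <= Q -> phase i Q = phase i' Q %[mod W c].
  exact: in_phase mi mi' lt_p lt_f le_P near.
have gap_gt0 b' : 0 < gap c b' by have := dW c; case: b' => /=; lia.
have A3' : at_crit c (~~ b) i' A by rewrite /at_crit -sync.
have [le_A|lt_A] := leqP A' A.
  have le_gap := next_crit A1 le_A A3 A3' (or_intror (gap_gt0 _)).
  by eexists; [apply: (value_crit A1 A3) | lia].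
have le_i'A : pos i' <= A by lia.
have A3b : at_crit c (~~ ~~ b) i' A' by rewrite negbK.
have le_gap := next_crit le_i'A (ltnW lt_A) A3' A3b (or_introl lt_A).
by eexists; [apply: (value_crit le_i'A A3') | lia].
Qed.

Lemma first_window c b i : window c b i -> exists A, [/\ pos i <= A,
  A + o c <= fin i, at_crit c b i A &
  forall P, pos i <= P -> at_crit c b i P -> A <= P].
Proof.
move=> [A0 [h1 h2 h3]].
pose Q A := (pos i <= A) && (phase i A %% W c == crit c b %% W c).
have exQ : exists A, Q A by exists A0; rewrite /Q h1 h3 eqxx.
case: (ex_minnP exQ) => A /andP[q1 /eqP q2] Amin; exists A; split=> //.
- by have := Amin A0; rewrite /Q h1 h3 eqxx => /(_ isT); lia.
- by move=> P p1 p2; apply: Amin; rewrite /Q p1 p2 eqxx.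
Qed.

(** Both rest on [W c < 15 p / 26]; 38 is 22 * 26 / 15 rounded down. *)
Lemma hard_arith c i P e p : hard c i P e p -> 38 * W c < 22 * p /\ 11 * W c < 15 * e.
Proof. by case=> _ _ h1 [h2 h3 _]; lia. Qed.

Lemma strong_short c b i : mem c i -> window c b i -> 52 * gap c b <= 22 * W c ->
  26 * o c + 52 * gap c b <= 63 * W c ->
  strong c i (52%:Z * (o c)%:Z - 74%:Z * (W c)%:Z)%R.
Proof.
move=> mi wi g1 g2; have [A [A1 A2 A3 Amin]] := first_window wi.
have gN := gapN c b; have gN' := gapN c (~~ b).
split=> //; first by eexists; [apply: value_crit A1 A3 | lia].
move=> P e p hP; have [a1 a2] := hard_arith hP.
case: hP => le_P fE lt_p [h1 h2 [[b' lt_g]|[b' eP]]].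
  have [bb|bb] := eqVneq b' b; last first.
    have {}bb := neq_negb bb.
    by subst b'; lia.
  by subst b'; eexists; [apply: value_crit A1 A3 | lia].
have [le_AP|lt_PA] := leqP A P.
  by eexists; [apply: value_crit A1 A3 | lia].
have bb : b = ~~ b'.
  apply: neq_negb; apply: contraTneq lt_PA => bb.
  by rewrite -leqNgt; apply: Amin; rewrite // bb.
have le_gap := next_crit le_P (ltnW lt_PA) eP; rewrite -bb in le_gap.
have {}le_gap := le_gap A3 (or_introl lt_PA).
by eexists; [apply: value_crit le_P eP | lia].
Qed.

Lemma strong_both c i : mem c i -> window c false i -> window c true i ->
  strong c i (52%:Z * (o c)%:Z - 74%:Z * (W c)%:Z)%R.
Proof.
move=> mi w1 w2; have [v vv le_v] := both_windows w1 w2.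
by split=> //; [exists v => //; lia | move=> P e p _; exists v => //; lia].
Qed.

(** One half of a pair: as the two gaps add up to [W c], the two amounts add up to [52 o - 74 W].
    The missing second window forces [W c + e < o c] when a hard position is critical of the other
    kind. *)
Lemma strong_two c b i : mem c i -> window c b i -> ~ window c (~~ b) i ->
  41 * W c <= 26 * o c -> (forall b', 63 * W c <= 26 * o c + 52 * gap c b') ->
  strong c i (26%:Z * (o c)%:Z - 11%:Z * (W c)%:Z - 52%:Z * (gap c b)%:Z)%R.
Proof.
move=> mi wi nwi g1 g2; have [A [A1 A2 A3 Amin]] := first_window wi.
split=> //; first by eexists; [apply: value_crit A1 A3 | lia].
move=> P e p hP; have [a1 a2] := hard_arith hP.
case: hP => le_P fE lt_p [h1 h2 [[b' lt_g]|[b' eP]]].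
  by have := g2 b'; eexists; [apply: value_crit A1 A3 | lia].
have [bb|bb] := eqVneq b' b.
  have le_AP : A <= P by apply: Amin; rewrite // -bb.
  by eexists; [apply: value_crit A1 A3 | lia].
have {}bb := neq_negb bb.
have lt_o : W c + e < o c.
  by rewrite ltnNge; apply/negP => ge_o; apply: nwi; exists P; split; rewrite -?bb //; lia.
by eexists; [apply: value_crit A1 A3 | lia].
Qed.

(** Large gaps rule out the first alternative of [hard]. In the second one the unrepeated factor
    from [P] has value above [52 e + 22 W], and [82 W - 22 W - 38 W = 22 W], by [26 o < 41 W] and
    [hard_arith]. *)
Lemma strong_big c i v R : mem c i -> big_gaps c -> value c i v ->
  (R + 52%:Z * (W c)%:Z <= v)%R -> (R <= 52%:Z * (o c)%:Z - 74%:Z * (W c)%:Z)%R ->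
  strong c i R.
Proof.
move=> mi [g1 g2 g3] vv le_v le_R; split=> //; first by exists v.
move=> P e p hP; have [a1 a2] := hard_arith hP.
case: hP => le_P fE lt_p [h1 h2 [[b' lt_g]|[b' eP]]].
  by have := g1 b'; lia.
have := g1 (~~ b'); have := gapN c b' => gN g1'.
by eexists; [apply: value_crit le_P eP | lia].
Qed.

(* The reason why K cannot be decreased in [good c b K]. *)
Definition tight c b K := exists s l, [/\ 0 < s < W c, shift_eq (al c) (crit c b) s l &
  K + 22 * s <= 52 * l \/ (l + W c + s <= o c /\ K <= 52 * l)].

Lemma good_min c b : exists K, [/\ 22 * W c <= K, good c b K &
  K = 22 * W c \/ tight c b K].
Proof.
have goodK : good c b (74 * W c).
  move=> s l sW m; suff : l < gap c b by have := gap_leW c b; lia.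
  rewrite ltnNge; apply/negP => le_g; apply: (@unrepeated_crit c b s) => //.
  by move=> k kg; apply: m; apply: leq_trans le_g.
have : 22 * W c <= 74 * W c by rewrite leq_mul2r orbT.
move: (74 * W c) goodK => K; elim: K => [|K IHK] gK le_K.
  by exists 0; split=> //; left; lia.
have [K0|lt_K] := eqVneq K.+1 (22 * W c); first by exists K.+1; split=> //; left.
have [gK'|ngK] := classic (good c b K).
  by apply: IHK => //; clear - le_K lt_K; lia.
exists K.+1; split=> //; right.
apply: NNPP => nt; apply: ngK => s l sW m; apply: NNPP => h; apply: nt.
by exists s, l; split=> //; clear - h; lia.
Qed.

(** Extending the run until it breaks supplies the breaking letters from which [two_runs] builds its
    factor. *)
Lemma tight_maximal c b K : tight c b K -> exists s l, [/\ 0 < s < W c,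
  shift_eq (al c) (crit c b) s l, l < gap c b,
  olt b (al c (crit c b + l)) (al c (crit c b + s + l)) &
  K <= 52 * l /\ (K + 22 * s <= 52 * l \/ 52 * W c + 52 * s + K <= 52 * o c)].
Proof.
move=> [s [l0 [sW m0 h0]]]; have [l [ml hl]] := @least_rot_crit c b s sW.
have le_l : l0 <= l.
  by rewrite leqNgt; apply/negP => lt_l; rewrite m0 ?olt_irr in hl.
exists s, l; split=> //; last by clear - h0 le_l; lia.
rewrite ltnNge; apply/negP => le_g; apply: (@unrepeated_crit c b s) => //.
by move=> k kg; apply: ml; apply: leq_trans le_g.
Qed.

Lemma unique_factor c K K' : big_gaps c -> 22 * W c < K -> 22 * W c < K' ->
  tight c false K -> tight c true K' -> 52 * o c < K + K' + 30 * W c ->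
  exists t u, unrepeated (al c) (W c) t u /\ 26 * u <= 11 * W c.
Proof.
move=> [g1 g2 _] lK lK' /tight_maximal[s [l [/andP[s0 _] m1 l1d rise [h1 h1']]]].
move=> /tight_maximal[s' [l' [/andP[s'0 _] m2 l2d drop [h2 h2']]]] hKK.
have := g1 false; have := g1 true; have ldW := dW c.
rewrite /gap /= in l1d l2d * => gt gf; rewrite /= in m1 m2 rise drop.
have := divn_eq (11 * W c) 26; have := ltn_pmod (11 * W c) (isT : 0 < 26).
(* A unique factor of at most [11 W / 26] letters has value at least [52 o - 22 W], all that is
   wanted. *)
set L := _ %/ 26; set r := _ %% 26 => rL LE.
suff [t ut] : exists t, unrepeated (al c) (W c) t L.
  by exists t, L; split=> //; clear - LE; lia.
(* The second length condition of [two_runs] counts [s1] twice, so [s1] must be the smaller shift.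
   In the other case the order is reversed and the least rotation is read one period later. *)
have [le_ss|lt_ss] := leqP s s'.
- apply: (two_runs ltn_irr ltn_tr (perW c) (i := i0 c) (j := i0 c + d c)
    (d := d c) (d' := W c - d c) (s1 := s) (l1 := l) (s2 := s') (l2 := l')) => //.
  + by clear - ldW; lia.
  + by clear - lK h1 LE; lia.
  + by clear - lK' h2 LE; lia.
  + by clear - le_ss l1d l2d h1 h2 h1' h2' hKK gt gf lK lK' rL LE g2; lia.
  + by clear - le_ss l1d l2d h1 h2 h1' h2' hKK gt gf lK lK' rL LE g2; lia.
- have E k : al c (i0 c + W c + k) = al c (i0 c + k) by rewrite addnAC perW.
  apply: (two_runs gtn_irr gtn_tr (perW c) (i := i0 c + d c) (j := i0 c + W c)
    (d := W c - d c) (d' := d c) (s1 := s') (l1 := l') (s2 := s) (l2 := l)) => //.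
  + by clear - ldW; lia.
  + by clear - ldW; lia.
  + by move=> k /m1 e; rewrite -(addnA _ s) !E addnA.
  + by rewrite E -(addnA (_ + _)) E addnA.
  + by clear - lK' h2 LE; lia.
  + by clear - lK h1 LE; lia.
  + by clear - lt_ss l1d l2d h1 h2 h1' h2' hKK gt gf lK lK' rL LE g2; lia.
  + by clear - lt_ss l1d l2d h1 h2 h1' h2' hKK gt gf lK lK' rL LE g2; lia.
Qed.

(* The two ways to collect 52 o_c - 74 W_c from a culprit: from one string, or
   shared by two strings, one for each critical rotation. *)
Definition alone c i := strong c i (52%:Z * (o c)%:Z - 74%:Z * (W c)%:Z)%R.

Definition paired c i1 R1 i2 R2 := [/\ i1 != i2, strong c i1 R1, strong c i2 R2,
  window c false i1 & [/\ window c true i2, 0 < d c &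
  (R1 + R2 = 52%:Z * (o c)%:Z - 74%:Z * (W c)%:Z)%R]].

Lemma cover_window c b : exists2 i, mem c i & window c b i.
Proof.
have [i [mi [A [A1 A2 A3]]]] := cover c (crit c b).
by exists i => //; exists A.
Qed.

Lemma alone_or_two c : (exists i, alone c i) \/ exists i1 i2, [/\ i1 != i2,
  mem c i1 /\ mem c i2, window c false i1 /\ window c true i2,
  ~ window c true i1 /\ ~ window c false i2 & 0 < d c].
Proof.
have [i1 m1 w1] := cover_window c false; have [i2 m2 w2] := cover_window c true.
have [w1'|n1] := classic (window c true i1); first by left; exists i1; apply: strong_both.
have [w2'|n2] := classic (window c false i2); first by left; exists i2; apply: strong_both.
right; exists i1, i2; split=> //; first by apply/eqP => e; apply: n1; rewrite e.
rewrite lt0n; apply/eqP => d0; apply: n1.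
by case: w1 => A [A1 A2 A3]; exists A; split=> //; rewrite /at_crit /= d0 addn0.
Qed.

Lemma select_ex c : 37 * W c < 26 * o c ->
  (exists i, alone c i) \/ exists i1 R1 i2 R2, paired c i1 R1 i2 R2.
Proof.
move=> lt_o.
have [[b [h1 h2]]|nshort] := classic (exists b,
    52 * gap c b <= 22 * W c /\ 26 * o c + 52 * gap c b <= 63 * W c).
  by have [i mi wi] := cover_window c b; left; exists i; apply: strong_short h1 h2.
have gN : gap c true + gap c false = W c := gapN c true.
(* 63 = 41 + 22: for [41 W <= 26 o] both alternatives give the bound of [strong_two], and for
   smaller [o] both give large gaps. *)
have {nshort}g2 b : 22 * W c < 52 * gap c b \/ 63 * W c < 26 * o c + 52 * gap c b.
  apply: NNPP => h; apply: nshort; exists b; clear - h; lia.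
have [le_o|lt_o'] := leqP (41 * W c) (26 * o c).
  have g3 b : 63 * W c <= 26 * o c + 52 * gap c b by have := g2 b; clear - le_o; lia.
  have [|[i1 [i2 [n12 [m1 m2] [w1 w2] [n1 n2] d0]]]] := alone_or_two c; first by left.
  right; exists i1, (26%:Z * (o c)%:Z - 11%:Z * (W c)%:Z - 52%:Z * (gap c false)%:Z)%R,
    i2, (26%:Z * (o c)%:Z - 11%:Z * (W c)%:Z - 52%:Z * (gap c true)%:Z)%R; split=> //.
  - exact: (@strong_two c false).
  - exact: (@strong_two c true).
  - by split=> //; clear - gN; lia.
have big : big_gaps c.
  by split=> // b; have := g2 b; clear - lt_o'; lia.
have [K [le_K gK tK]] := good_min c false; have [K' [le_K' gK' tK']] := good_min c true.
have one b K0 : good c b K0 -> K0 = 22 * W c -> exists i, alone c i.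
  move=> g0 K0E; have [i mi [A [A1 A2 A3]]] := cover_window c b; exists i.
  apply: (strong_big (v := (52%:Z * (o c)%:Z - K0%:Z)%R) mi big) => //.
    by right; exists A, b, K0; split=> //; split=> //; rewrite K0E.
  by rewrite K0E; clear; lia.
case: tK => [KE|tK]; first by left; apply: one gK KE.
case: tK' => [KE|tK']; first by left; apply: one gK' KE.
have [KE|nK] := eqVneq K (22 * W c); first by left; apply: one gK KE.
have [KE|nK'] := eqVneq K' (22 * W c); first by left; apply: one gK' KE.
(* 30 = 52 - 22: [K + K' + 30 W <= 52 o] says that the second string can pay the part [K - 22 W]
   left over by the first. *)
have [lt_KK|le_KK] := ltnP (52 * o c) (K + K' + 30 * W c).
  have lt_K : 22 * W c < K by rewrite ltn_neqAle eq_sym nK.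
  have lt_K' : 22 * W c < K' by rewrite ltn_neqAle eq_sym nK'.
  have [t [u [ut le_u]]] := unique_factor big lt_K lt_K' tK tK' lt_KK.
  have [i [mi [A [A1 A2 A3]]]] := cover c t; left; exists i.
  apply: (strong_big (v := (52%:Z * ((fin i)%:Z - A%:Z - u%:Z))%R) mi big) => //.
    by left; exists A, u; split=> //; apply: (unrepeated_mod (perW c) _ ut); rewrite -A3.
  by clear - le_u A2; lia.
have [|[i1 [i2 [n12 [m1 m2] [w1 w2] [n1 n2] d0]]]] := alone_or_two c; first by left.
right; exists i1, (52%:Z * (o c)%:Z - K%:Z - 52%:Z * (W c)%:Z)%R, i2,
  (K%:Z - 22%:Z * (W c)%:Z)%R.
split=> //.
- case: w1 => A [A1 A2 A3].
  apply: (strong_big (v := (52%:Z * (o c)%:Z - K%:Z)%R) m1 big).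
  + by right; exists A, false, K; split.
  + by clear; lia.
  + by clear - le_K; lia.
- case: w2 => A [A1 A2 A3].
  apply: (strong_big (v := (52%:Z * (o c)%:Z - K'%:Z)%R) m2 big).
  + by right; exists A, true, K'; split.
  + by clear - le_KK; lia.
  + by clear - le_KK le_K'; lia.
- by split=> //; clear; lia.
Qed.

(** * Summing the charges along the superstring *)

Section Selection.
Variables (sel : C -> seq (I * int)) (n : nat).
Hypothesis selP : forall c, 37 * W c < 26 * o c ->
  (exists2 i, alone c i & sel c = [:: (i, 52%:Z * (o c)%:Z - 74%:Z * (W c)%:Z)%R]) \/
  exists i1 R1 i2 R2, paired c i1 R1 i2 R2 /\ sel c = [:: (i1, R1); (i2, R2)].
Hypothesis sel0 : forall c, 26 * o c <= 37 * W c -> sel c = [::].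
Hypothesis mem_inj : forall c c' i, mem c i -> mem c' i -> c = c'.
Hypothesis co_sorted : forall c c' i i', mem c i -> mem c' i' -> i != i' ->
  pos i <= pos i' -> pos i < pos i' /\ fin i < fin i'.
Hypothesis fin_le : forall c i, mem c i -> fin i <= n.

Lemma sel_strong c x : x \in sel c -> strong c x.1 x.2.
Proof.
have [/sel0 -> //|/selP[[i si ->]|[i1 [R1 [i2 [R2 [[_ s1 s2 _ _] ->]]]]]]] :=
  leqP (26 * o c) (37 * W c); first by rewrite inE => /eqP ->.
by rewrite !inE => /orP[] /eqP ->.
Qed.

Lemma sel_mem c x : x \in sel c -> mem c x.1.
Proof. by case/sel_strong. Qed.

Lemma sel_pair c x y : x \in sel c -> y \in sel c -> x != y ->
  exists b, [/\ window c b x.1, window c (~~ b) y.1, x.1 != y.1, 0 < d c &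
    (x.2 + y.2 = 52%:Z * (o c)%:Z - 74%:Z * (W c)%:Z)%R].
Proof.
have [/sel0 -> //|/selP[[i si ->]|]] := leqP (26 * o c) (37 * W c).
  by rewrite !inE => /eqP -> /eqP ->; rewrite eqxx.
move=> [i1 [R1 [i2 [R2 [[n12 s1 s2 w1 [w2 d0 e]] ->]]]]].
rewrite !inE => /orP[]/eqP-> /orP[]/eqP->; rewrite ?eqxx // => _.
  by exists false.
by exists true; split=> //; [rewrite eq_sym | rewrite addrC].
Qed.

Lemma sel_three c x y z : x \in sel c -> y \in sel c -> z \in sel c ->
  x != y -> y != z -> x != z -> False.
Proof.
have [/sel0 -> //|/selP[[i si ->]|[i1 [R1 [i2 [R2 [_ ->]]]]]]] :=
  leqP (26 * o c) (37 * W c); rewrite !inE.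
  by move=> /eqP -> /eqP ->; rewrite eqxx.
by move=> /orP[]/eqP-> /orP[]/eqP-> /orP[]/eqP->; rewrite ?eqxx.
Qed.

Definition item_le : rel (C * (I * int)) := fun x y => pos x.2.1 <= pos y.2.1.

Definition item x := x.2 \in sel x.1.

Lemma item_lt x y : item x -> item y -> x != y -> item_le x y ->
  pos x.2.1 < pos y.2.1 /\ fin x.2.1 < fin y.2.1.
Proof.
case: x y => [c x] [c' y]; rewrite /item /item_le /= => ix iy nxy.
apply: (co_sorted (sel_mem ix) (sel_mem iy)).
have [e|ncc] := eqVneq c c'.
  subst c'; have [|b [_ _ //]] := sel_pair ix iy.
  by apply: contraNneq nxy => ->.
apply: contraNneq ncc => e; apply/eqP.
by apply: (mem_inj (sel_mem ix)); rewrite e (sel_mem iy).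
Qed.

Definition total (s : seq (C * (I * int))) : int := (\sum_(y <- s) y.2.2)%R.

Lemma total_cons x s : total (x :: s) = (x.2.2 + total s)%R.
Proof. exact: big_cons. Qed.

Lemma total_nil : total [::] = 0%R.
Proof. exact: big_nil. Qed.

(** The strings are charged from the right. If the two strings of a culprit are paid together by
    [charge_merge], its [52 o] exceeds their amounts by [74 W]; this is exactly what [charge_weak]
    needs to charge the next string, which belongs to another culprit. *)
Lemma charge_chain x s : path item_le x s -> uniq (x :: s) -> all item (x :: s) ->
  exists2 v, value x.1 x.2.1 v &
    (total (x :: s) <= v + 52%:Z * (n%:Z - (fin x.2.1)%:Z))%R.
Proof.
have [m] := ubnP (size s); elim: m s x => // m IHm [|y s] x; rewrite ltnS => le_m.
  case: x => [c [i R]] _ _ /andP[ix _]; have [/= mx [v vv le_v] _] := sel_strong ix.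
  exists v => //; have := fin_le mx; rewrite total_cons total_nil /=.
  by clear - le_v; lia.
rewrite /= => /andP[le_xy py] /andP[]; rewrite inE negb_or => /andP[nxy xs] uy.
move=> /andP[ix /andP[iy js]].
have [v vy le_v] := IHm s y le_m py uy (introT andP (conj iy js)).
have [lp lf] := item_lt ix iy nxy le_xy.
have sx := sel_strong ix; have sy := sel_strong iy; have my := sel_mem iy.
case: x => [c [i R]] in ix nxy xs le_xy lp lf sx *.
case: y => [c' [i' R']] in le_m py le_xy iy nxy xs uy v vy le_v lp lf sy my *.
rewrite /item /= in ix iy vy le_v lp lf sx sy my *.
have [cc|ncc] := eqVneq c' c; last first.
  have [v' vx le_v'] := charge_step ncc sx my lp lf vy.
  by exists v' => //; rewrite total_cons /=; clear - le_v' le_v; lia.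
subst c'; have nxy' : (i, R) != (i', R') by apply: contraNneq nxy => ->.
have [b [/= w1 w2 nij d0 eR]] := sel_pair ix iy nxy'.
have [[v' vx le_v']|[v' vx le_v']] := charge_merge sx my d0 w1 w2 lp lf vy.
  by exists v' => //; rewrite total_cons /=; clear - le_v' le_v; lia.
exists v' => //; rewrite 2!total_cons /=.
suff: (total s <= 74%:Z * (W c)%:Z + 52%:Z * (n%:Z - (fin i')%:Z))%R.
  by clear - le_v' eR; lia.
case: s le_m py uy xs js {le_v} => [|[c' [k R'']] s] le_m py uy xs js.
  by have := fin_le my; rewrite total_nil; clear; lia.
move: py uy xs js => /= /andP[le_yz pz] /andP[]; rewrite !inE !negb_or.
move=> /andP[nyz ys] uz /andP[nxz _] /andP[iz js].
have [u uz' le_u] := IHm s _ (ltnW le_m) pz uz (introT andP (conj iz js)).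
have [/= lp' lf'] := @item_lt (_, (_, _)) _ iy iz nyz le_yz.
apply: le_trans le_u _; rewrite /=.
have ncc : c' != c.
  apply/eqP => e; subst c'; apply: (sel_three ix iy iz nxy').
    by apply: contraNneq nyz => ->.
  by apply: contraNneq nxz => ->.
by have := charge_weak ncc (sel_mem iz) my lp' lf' uz'; rewrite /=; clear; lia.
Qed.

Lemma value_le c i v : value c i v -> (v <= 52%:Z * (fin i)%:Z)%R.
Proof. by case=> [[P [u [? _ ->]]]|[P [b [K [? ? _ _ [_ _ ->]]]]]]; lia. Qed.

Lemma charge_total : (\sum_c \sum_(x <- sel c) x.2 <= 52%:Z * n%:Z)%R.
Proof.
pose Q := sort item_le [seq (c, x) | c <- enum C, x <- sel c].
have perQ : perm_eq Q [seq (c, x) | c <- enum C, x <- sel c] by rewrite perm_sort.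
have QS : (total Q = \sum_c \sum_(x <- sel c) x.2)%R.
  by rewrite /total (perm_big _ perQ) /= big_allpairs_dep /= big_enum.
have iQ : all item Q.
  rewrite (perm_all _ perQ); apply/allP => y /allpairsPdep[c [x [_ xc ->]]].
  by rewrite /item.
have uQ : uniq Q.
  rewrite (perm_uniq perQ); apply: allpairs_uniq_dep.
  - exact: enum_uniq.
  - move=> c _; have [/sel0 -> //|/selP[[i si ->] //|]] := leqP (26 * o c) (37 * W c).
    move=> [i1 [R1 [i2 [R2 [[n12 _ _ _ _] ->]]]]] /=.
    by rewrite inE andbT; apply: contraNneq n12 => -[->].
  - by move=> [c x] [c' y] _ _ /= [-> ->].
have sQ : sorted item_le Q by apply: sort_sorted => x y; apply: leq_total.
rewrite -QS; case: Q {perQ QS} iQ uQ sQ => [|x s] iQ uQ sQ; first by rewrite total_nil.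
have [v vx le_v] := charge_chain sQ uQ iQ.
by have := value_le vx; lia.
Qed.

End Selection.

Definition selection c s :=
  if 37 * W c < 26 * o c then
    (exists2 i, alone c i & s = [:: (i, 52%:Z * (o c)%:Z - 74%:Z * (W c)%:Z)%R]) \/
    exists i1 R1 i2 R2, paired c i1 R1 i2 R2 /\ s = [:: (i1, R1); (i2, R2)]
  else s = [::].

Lemma selection_ex c : exists s, selection c s.
Proof.
rewrite /selection; have [lt_o|_] := ltnP (37 * W c) (26 * o c); last by exists [::].
have [[i ai]|[i1 [R1 [i2 [R2 h]]]]] := select_ex lt_o.
  by eexists; left; exists i.
by eexists; right; exists i1, R1, i2, R2.
Qed.

Theorem charging n :
  (forall c c' i, mem c i -> mem c' i -> c = c') ->
  (forall c c' i i', mem c i -> mem c' i' -> i != i' ->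
    pos i <= pos i' -> pos i < pos i' /\ fin i < fin i') ->
  (forall c i, mem c i -> fin i <= n) ->
  26 * \sum_c o c <= 26 * n + 37 * \sum_c W c.
Proof.
move=> h1 h2 h3.
have [sel selP] := functional_choice _ selection_ex.
have s1 c : 37 * W c < 26 * o c ->
  (exists2 i, alone c i & sel c = [:: (i, 52%:Z * (o c)%:Z - 74%:Z * (W c)%:Z)%R]) \/
  exists i1 R1 i2 R2, paired c i1 R1 i2 R2 /\ sel c = [:: (i1, R1); (i2, R2)].
  by move=> h; have := selP c; rewrite /selection h.
have s0 c : 26 * o c <= 37 * W c -> sel c = [::].
  by move=> h; have := selP c; rewrite /selection ltnNge h.
have le_n := charge_total s1 s0 h1 h2 h3.
have le_s : (\sum_c (52%:Z * (o c)%:Z - 74%:Z * (W c)%:Z) <=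
             \sum_c \sum_(x <- sel c) x.2 :> int)%R.
  apply: ler_sum => c _; have [h|h] := leqP (26 * o c) (37 * W c).
    by rewrite (s0 _ h) big_nil; clear - h; lia.
  have [[i _ ->]|[i1 [R1 [i2 [R2 [[_ _ _ _ [_ _ e]] ->]]]]]] := s1 _ h.
    by rewrite big_seq1.
  by rewrite big_cons big_seq1 /= e.
have := le_trans le_s le_n; rewrite sumrB -!mulr_sumr.
have -> : (\sum_c (o c)%:Z = (\sum_c o c)%N%:Z)%R by rewrite (raddf_sum Posz).
have -> : (\sum_c (W c)%:Z = (\sum_c W c)%N%:Z)%R by rewrite (raddf_sum Posz).
by move: (\sum_c o c) (\sum_c W c) => x y; clear; lia.
Qed.

End Charging.

(** * Greedy matchings *)

Section Overlap.
Variable T : eqType.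
Implicit Types s t u v : seq T.

(* Longest proper overlap; unlike [ov] it makes sense for s = t, where it is the
   longest border. *)
Definition ovl s t :=
  \max_(k < minn (size s) (size t) | drop (size s - k) s == take k t) k.

Lemma ovl_lt s t : 0 < size s -> 0 < size t -> ovl s t < size s /\ ovl s t < size t.
Proof.
move=> s0 t0; apply/andP; rewrite -leq_min.
rewrite -(prednK (n := minn _ _)) ?leq_min ?s0 // ltnS; apply/bigmax_leqP => k _.
by have := ltn_ord k; lia.
Qed.

Lemma ovl_gt0 s t : 0 < ovl s t -> 0 < size s /\ 0 < size t.
Proof.
rewrite lt0n; case: posnP => [s0|s0]; last case: posnP => [t0|//].
  by rewrite /ovl s0 min0n big_ord0.
by rewrite /ovl t0 minn0 big_ord0.
Qed.

Lemma ovlP s t : drop (size s - ovl s t) s = take (ovl s t) t.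
Proof.
rewrite /ovl; elim/big_ind: _ => [|x y hx hy|k /eqP //]; first by rewrite subn0 drop_size take0.
by case: leqP.
Qed.

Lemma ovl_max s t k : k < size s -> k < size t ->
  drop (size s - k) s = take k t -> k <= ovl s t.
Proof.
move=> ks kt e; have kst : k < minn (size s) (size t) by rewrite leq_min ks.
exact: (leq_bigmax_cond (Ordinal kst) (introT eqP e)).
Qed.

(** Inside the overlap of [u] and [v], of length [M], lie a suffix of length [a] and a prefix of
    length [b]. They share [a + b - M] letters, which form a suffix of [u'] and a prefix of [v']. *)
Lemma ovl_monge u v u' v' :
  ovl u v' <= ovl u v -> ovl u' v <= ovl u v ->
  ovl u v' + ovl u' v <= ovl u v + ovl u' v'.
Proof.
set M := ovl u v; set a := ovl u v'; set b := ovl u' v => aM bM.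
have [|lt_M] := leqP (a + b) M; first by lia.
have [u0 v'0] : 0 < size u /\ 0 < size v' by apply: ovl_gt0; rewrite -/a; lia.
have [u'0 v0] : 0 < size u' /\ 0 < size v by apply: ovl_gt0; rewrite -/b; lia.
suff : a + b - M <= ovl u' v' by lia.
have [Mu Mv] := ovl_lt u0 v0; have [au av] := ovl_lt u0 v'0; have [bu bv] := ovl_lt u'0 v0.
rewrite -/M -/a -/b in Mu Mv au av bu bv.
apply: ovl_max; [by lia | by lia | ].
have -> : size u' - (a + b - M) = (M - a) + (size u' - b) by lia.
rewrite -drop_drop ovlP -/b.
rewrite -[RHS](take_takel _ (_ : a + b - M <= a)); last by lia.
rewrite -(ovlP u v') -/a; have -> : size u - a = (M - a) + (size u - M) by lia.
rewrite -drop_drop ovlP -/M take_drop take_takel; last by lia.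
by congr (drop _ (take _ _)); lia.
Qed.

End Overlap.

Lemma max_weight (A : eqType) (f : A -> nat) (s : seq A) : s != [::] ->
  exists2 x, x \in s & forall y, y \in s -> f y <= f x.
Proof.
elim: s => // x [|y s] IHs _; first by exists x; rewrite ?mem_head // => y /[1!inE] /eqP ->.
have [//|z zs zmax] := IHs; have [le_xz|lt_zx] := leqP (f x) (f z).
  by exists z; [rewrite inE zs orbT | move=> t /[1!inE] /predU1P[->|/zmax]].
exists x => [|t]; first exact: mem_head.
by rewrite inE => /predU1P[->|/zmax /leq_trans -> //]; rewrite // ltnW.
Qed.

Section GreedyBound.
Variables (X : eqType) (al : rel X) (wt : X -> X -> nat).
Implicit Types (N : seq (X * X)) (os : seq (option X * option X * nat)).
Hypothesis monge : forall u v u' v', wt u v' <= wt u v -> wt u' v <= wt u v ->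
  wt u v' + wt u' v <= wt u v + wt u' v'.

(* An object is a possible edge with a weight, [None] marking a missing end. *)
Definition dominated os (us vs : seq X) := forall u v, u \in us -> v \in vs ->
  al u v -> 0 < wt u v -> exists2 x, x \in os &
  ((x.1.1 == Some u) || (x.1.2 == Some v)) && (wt u v <= x.2).

Lemma mem_unzip1 N t : t \in unzip1 N -> exists v N', perm_eq N ((t, v) :: N').
Proof. by case/mapP => [[t' v] /perm_to_rem h ->]; exists v, (rem (t', v) N). Qed.

Lemma mem_unzip2 N h : h \in unzip2 N -> exists u N', perm_eq N ((u, h) :: N').
Proof. by case/mapP => [[u h'] /perm_to_rem p ->]; exists u, (rem (u, h') N). Qed.

Let oin (o : option X) (s : seq X) := if o is Some t then t \in s else false.

(* The weights of a matching are exchanged against the objects one by one, from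
   the heaviest on: this is the analysis of the greedy matching algorithm for
   Monge weights. *)
Lemma greedy_bound os N :
  (forall t h w, (Some t, Some h, w) \in os ->
     wt t h = w /\ forall u v, al t v -> al u h -> al u v) ->
  uniq (unzip1 N) -> uniq (unzip2 N) -> all (fun p => al p.1 p.2) N ->
  dominated os (unzip1 N) (unzip2 N) ->
  \sum_(p <- N) wt p.1 p.2 <= \sum_(x <- os) x.2.
Proof.
have [n] := ubnP (size os); elim: n os N => // n IHn os N; rewrite ltnS => le_n.
move=> real u1 u2 aN dom.
have [os0|/(max_weight snd)[[[ot oh] w] /= xos xmax]] := eqVneq os [::].
  rewrite big1_seq // => p /= pN; apply/eqP; rewrite -leqn0 leqNgt; apply/negP => lt_p.
  have [||||x] := dom p.1 p.2; rewrite ?map_f ?os0 //.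
  by rewrite (allP aN).
have wtN p : p \in N -> wt p.1 p.2 <= w.
  move=> pN; have [->|lt_p] := posnP (wt p.1 p.2); first by [].
  have [||||y yos /andP[_ le_y]] := dom p.1 p.2; rewrite ?map_f ?(allP aN) //.
  by rewrite (leq_trans le_y) ?xmax.
have pos := perm_to_rem xos.
have mem_os y : (y \in os) = (y == (ot, oh, w)) || (y \in rem (ot, oh, w) os).
  by rewrite (perm_mem pos) inE.
(* Freeing both ends of the heaviest object costs at most [w]; every edge dominated through these
   ends is then gone. *)
suff [N' [u1' u2' aN' [s1 s2] [n1 n2 le_N]]] : exists N',
    [/\ uniq (unzip1 N'), uniq (unzip2 N'), all (fun p => al p.1 p.2) N',
        {subset unzip1 N' <= unzip1 N} /\ {subset unzip2 N' <= unzip2 N} &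
        [/\ ~~ oin ot (unzip1 N'), ~~ oin oh (unzip2 N') &
        \sum_(p <- N) wt p.1 p.2 <= w + \sum_(p <- N') wt p.1 p.2]].
  rewrite (perm_big _ pos) big_cons /= (leq_trans le_N) // leq_add2l.
  apply: IHn => //.
  - by rewrite size_rem //; case: (os) xos le_n.
  - by move=> t h v h1; apply: real; rewrite mem_os h1 orbT.
  move=> u v uN vN auv lt_uv; have [y] := dom u v (s1 _ uN) (s2 _ vN) auv lt_uv.
  rewrite mem_os => /predU1P[->|yos h]; last by exists y.
  case/andP=> /orP[] /= /eqP e _; first by rewrite e /= uN in n1.
  by rewrite e /= vN in n2.
have [tN|tN] := boolP (oin ot (unzip1 N)); last first.
  have [hN|hN] := boolP (oin oh (unzip2 N)); last first.
    by exists N; split=> //; split=> //; rewrite leq_addl.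
  case: oh hN {xos pos mem_os} => // h /mem_unzip2[u [N1 pN]].
  have hN1 : h \notin unzip2 N1.
    by move: u2; rewrite (perm_uniq (perm_map snd pN)) /= => /andP[].
  have s1 : {subset unzip1 N1 <= unzip1 N}.
    by move=> z zN; rewrite (perm_mem (perm_map fst pN)) inE zN orbT.
  exists N1; split.
  - by move: u1; rewrite (perm_uniq (perm_map fst pN)) /= => /andP[].
  - by move: u2; rewrite (perm_uniq (perm_map snd pN)) /= => /andP[].
  - by move: aN; rewrite (perm_all _ pN) /= => /andP[].
  - by split=> // z zN; rewrite (perm_mem (perm_map snd pN)) inE zN orbT.
  - split=> //; first by case: ot tN => // t; apply: contra; apply: s1.
    rewrite (perm_big _ pN) big_cons leq_add2r /=.
    by apply: (wtN (u, h)); rewrite (perm_mem pN) mem_head.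
case: ot tN xos pos mem_os => // t /mem_unzip1[v [N1 pN]] xos pos mem_os.
have tN1 : t \notin unzip1 N1.
  by move: u1; rewrite (perm_uniq (perm_map fst pN)) /= => /andP[].
have vN1 : v \notin unzip2 N1.
  by move: u2; rewrite (perm_uniq (perm_map snd pN)) /= => /andP[].
have s1 : {subset unzip1 N1 <= unzip1 N}.
  by move=> z zN; rewrite (perm_mem (perm_map fst pN)) inE zN orbT.
have s2 : {subset unzip2 N1 <= unzip2 N}.
  by move=> z zN; rewrite (perm_mem (perm_map snd pN)) inE zN orbT.
have vN : v \in unzip2 N by rewrite (perm_mem (perm_map snd pN)) mem_head.
have u1' : uniq (unzip1 N1) by move: u1; rewrite (perm_uniq (perm_map fst pN)) /= => /andP[].
have u2' : uniq (unzip2 N1) by move: u2; rewrite (perm_uniq (perm_map snd pN)) /= => /andP[].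
have [atv aN1] : al t v /\ all (fun p => al p.1 p.2) N1.
  by move: aN; rewrite (perm_all _ pN) /= => /andP[].
have le_tv : wt t v <= w by apply: (wtN (t, v)); rewrite (perm_mem pN) mem_head.
have [hN|hN] := boolP (oin oh (unzip2 N1)); last first.
  by exists N1; split=> //; split=> //; rewrite (perm_big _ pN) big_cons leq_add2r.
case: oh hN xos {pos mem_os} => // h /mem_unzip2[u [N2 pN2]] xos.
have [wth alx] := real _ _ _ xos.
have hN2 : h \notin unzip2 N2.
  by move: u2'; rewrite (perm_uniq (perm_map snd pN2)) /= => /andP[].
have uN1 : u \in unzip1 N1 by rewrite (perm_mem (perm_map fst pN2)) mem_head.
have hN1 : h \in unzip2 N1 by rewrite (perm_mem (perm_map snd pN2)) mem_head.
have [auh aN2] : al u h /\ all (fun p => al p.1 p.2) N2.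
  by move: aN1; rewrite (perm_all _ pN2) /= => /andP[].
have s2' : {subset unzip2 N2 <= unzip2 N1}.
  by move=> z zN; rewrite (perm_mem (perm_map snd pN2)) inE zN orbT.
have pN12 : unzip1 N1 =i unzip1 ((u, v) :: N2) by apply/perm_mem; exact: (perm_map fst pN2).
(* The exchange: [(t, v)] and [(u, h)] are replaced by the object [(t, h)] and the edge [(u, v)]. *)
exists ((u, v) :: N2); split.
- by move: u1'; rewrite (perm_uniq (perm_map fst pN2)).
- rewrite /= (contra (@s2' v) vN1) /=.
  by move: u2'; rewrite (perm_uniq (perm_map snd pN2)) /= => /andP[].
- by rewrite /= aN2 (alx _ _ atv auh).
- by split=> z; [rewrite -pN12; apply: s1 | rewrite inE => /predU1P[->//|/s2'/s2]].
- split; [by rewrite /oin -pN12 | | ].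
    by rewrite /= inE negb_or hN2 andbT; apply: contraNneq vN1 => <-.
  rewrite (perm_big _ pN) 2!big_cons (perm_big _ pN2) big_cons /= !addnA leq_add2r -wth.
  apply: monge; rewrite wth //; apply: (wtN (u, h)).
  by rewrite (perm_mem pN) inE (perm_mem pN2) mem_head orbT.
Qed.

End GreedyBound.

(** * Matchings read off from linear and cyclic words *)

Section Occurrences.
Variables (T : eqType) (x0 : T).
Implicit Types (s t : seq T) (f : nat -> T).

Definition occurs f P s := forall k, k < size s -> nth x0 s k = f (P + k).

Lemma ovl_occurs f P Q s t : occurs f P s -> occurs f Q t ->
  P < Q -> P + size s < Q + size t -> P + size s - Q <= ovl s t.
Proof.
move=> os ot lt_P lt_f; set k := _ - _.
have [-> //|k_gt0] := posnP k; apply: ovl_max; [by lia | by lia |].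
apply: (@eq_from_nth _ x0); first by rewrite size_drop size_takel; lia.
move=> i; rewrite size_drop => lt_i.
rewrite nth_drop nth_take; last by lia.
by rewrite os ?ot; [congr f; lia | lia | lia].
Qed.

Lemma occurs_infix f P Q s t : occurs f P s -> occurs f Q t ->
  P <= Q -> Q + size t <= P + size s -> infix t s.
Proof.
move=> os ot le_P le_f; apply/infixP; exists (take (Q - P) s), (drop (Q - P + size t) s).
rewrite catA -[LHS](cat_take_drop (Q - P + size t)); congr (_ ++ _).
rewrite takeD; congr (_ ++ _); apply: (@eq_from_nth _ x0).
  by rewrite size_takel // size_drop; lia.
rewrite size_takel ?size_drop; last by lia.
move=> i lt_i; rewrite nth_take // nth_drop os ?ot //; last by lia.
by congr f; lia.
Qed.

Lemma infix_occurs s (w : seq T) : infix s w ->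
  exists2 P, occurs (nth x0 w) P s & P + size s <= size w.
Proof.
case/infixP => [p [q ->]]; exists (size p); last by rewrite !size_cat; lia.
by move=> k lt_k; rewrite nth_cat ltnNge leq_addr /= addKn nth_cat lt_k.
Qed.

Section Matching.
Variables (I : eqType) (st : I -> seq T).
Implicit Types (Q : seq I) (M : seq (I * I)).

Definition matches Q M := [/\ uniq (unzip1 M), uniq (unzip2 M),
  {subset unzip1 M <= Q} & {subset unzip2 M <= Q}].

Definition noninfix Q := {in Q &, forall i j, i != j -> ~~ infix (st i) (st j)}.

Variable f : nat -> T.

Lemma occurs_lt Q (pos : I -> nat) : noninfix Q -> {in Q, forall i, occurs f (pos i) (st i)} ->
  {in Q &, forall i j, i != j -> pos i <= pos j ->
     pos i < pos j /\ pos i + size (st i) < pos j + size (st j)}.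
Proof.
move=> ni oc i j iQ jQ nij le_p.
have nji : j != i by rewrite eq_sym.
have lt_f : pos i + size (st i) < pos j + size (st j).
  rewrite ltnNge; apply: contra (ni j i jQ iQ nji) => le_f.
  exact: occurs_infix (oc _ iQ) (oc _ jQ) le_p le_f.
split=> //; rewrite ltn_neqAle le_p andbT; apply: contra (ni i j iQ jQ nij) => /eqP e.
apply: (occurs_infix (oc _ jQ) (oc _ iQ)); first by rewrite e.
exact: ltnW.
Qed.

Definition conseq x Q := zip (belast x Q) Q.

Lemma conseq_cons x y Q : conseq x (y :: Q) = (x, y) :: conseq y Q.
Proof. by []. Qed.

Lemma unzip_conseq x Q : unzip1 (conseq x Q) = belast x Q /\ unzip2 (conseq x Q) = Q.
Proof. by rewrite unzip1_zip ?unzip2_zip ?size_belast. Qed.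

Lemma chain_bound (pos : I -> nat) x Q : uniq (x :: Q) -> noninfix (x :: Q) ->
  {in x :: Q, forall i, occurs f (pos i) (st i)} ->
  path (relpre pos leq) x Q ->
  pos x + \sum_(i <- x :: Q) size (st i) <=
  pos (last x Q) + size (st (last x Q)) + \sum_(p <- conseq x Q) ovl (st p.1) (st p.2) /\
  pos x <= pos (last x Q).
Proof.
elim: Q x => [|y Q IHQ] x; first by rewrite big_seq1 big_nil addn0.
move=> /= /andP[]; rewrite inE negb_or => /andP[nxy xQ] uQ ni oc /andP[le_xy pQ].
have sub : {subset y :: Q <= [:: x, y & Q]} by move=> z zQ; rewrite inE zQ orbT.
have [||le_s le_l] := IHQ y uQ _ _ pQ.
- by move=> i j iQ jQ; apply: ni; apply: sub.
- by move=> i iQ; apply: oc; apply: sub.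
have xin : x \in [:: x, y & Q] := mem_head _ _.
have yin : y \in [:: x, y & Q] by rewrite !inE eqxx orbT.
have [lt_p lt_f] := occurs_lt ni oc xin yin nxy le_xy.
have := ovl_occurs (oc _ xin) (oc _ yin) lt_p lt_f.
by move: le_s le_l; rewrite conseq_cons !big_cons /=; lia.
Qed.

Lemma sort_pos (pos : I -> nat) Q : exists2 Q', perm_eq Q' Q & sorted (relpre pos leq) Q'.
Proof.
exists (sort (relpre pos leq) Q); first by rewrite perm_sort.
by apply: sort_sorted => i j; apply: leq_total.
Qed.

Lemma path_matching Q n (pos : I -> nat) : uniq Q -> noninfix Q ->
  {in Q, forall i, occurs f (pos i) (st i)} ->
  {in Q, forall i, pos i + size (st i) <= n} ->
  exists2 M, matches Q M &
    \sum_(i <- Q) size (st i) <= n + \sum_(p <- M) ovl (st p.1) (st p.2).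
Proof.
have [Q' pQ] := sort_pos pos Q; have memQ := perm_mem pQ.
rewrite -(perm_uniq pQ) => sQ uQ ni oc le_n; rewrite -(perm_big _ pQ).
case: Q' pQ memQ uQ sQ => [|x Q'] pQ memQ uQ sQ; first by exists [::]; rewrite ?big_nil.
have [||h _] := chain_bound uQ _ _ sQ.
- by move=> i j; rewrite !memQ; apply: ni.
- by move=> i; rewrite memQ; apply: oc.
have [e1 e2] := unzip_conseq x Q'.
exists (conseq x Q'); last first.
  apply: leq_trans (leq_trans h _); first exact: leq_addl.
  by rewrite leq_add2r; apply: le_n; rewrite -memQ mem_last.
split; rewrite ?e1 ?e2.
- by move: uQ; rewrite lastI rcons_uniq => /andP[].
- by case/andP: uQ.
- by move=> z zQ; rewrite -memQ lastI mem_rcons inE zQ orbT.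
- by move=> z zQ; rewrite -memQ inE zQ orbT.
Qed.

(** Starts are reduced modulo [D], and the last string is joined to the first one read a period
    later. For a single string this edge is its overlap with itself, which is why [ovl] must be
    proper. *)
Lemma cycle_matching Q D (pos : I -> nat) : 0 < D -> (forall k, f (k + D) = f k) ->
  uniq Q -> noninfix Q -> {in Q, forall i, 0 < size (st i)} ->
  {in Q, forall i, occurs f (pos i) (st i)} ->
  exists2 M, matches Q M &
    \sum_(i <- Q) size (st i) <= D + \sum_(p <- M) ovl (st p.1) (st p.2).
Proof.
move=> D0 fD uQ ni s0 oc.
have fmod k : f (k %% D) = f k.
  rewrite [in RHS](divn_eq k D); elim: (k %/ D) => [|m IHm] //=.
  by rewrite mulSn -addnA addnC fD.
have {}oc : {in Q, forall i, occurs f (pos i %% D) (st i)}.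
  by move=> i iQ k lt_k; rewrite (oc i iQ k lt_k) -fmod -modnDml fmod.
have [Q' pQ sQ] := sort_pos (fun i => pos i %% D) Q; have memQ := perm_mem pQ.
rewrite -(perm_uniq pQ) in uQ; rewrite -(perm_big _ pQ).
case: Q' pQ memQ uQ sQ => [|x Q'] pQ memQ uQ sQ; first by exists [::]; rewrite ?big_nil.
have [||] := chain_bound uQ _ _ sQ.
- by move=> i j; rewrite !memQ; apply: ni.
- by move=> i; rewrite memQ; apply: oc.
set y := last x Q'; move=> h le_xy.
have [e1 e2] := unzip_conseq x Q'.
have xQ : x \in Q by rewrite -memQ mem_head.
have yQ : y \in Q by rewrite -memQ mem_last.
have ocx : occurs f (pos x %% D + D) (st x).
  by move=> k lt_k; rewrite addnAC fD; apply: oc.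
have lt_yD := ltn_pmod (pos y) D0; have x_gt0 := s0 _ xQ.
have lt_f : pos y %% D + size (st y) < pos x %% D + D + size (st x).
  have [->|nxy] := eqVneq x y; first by lia.
  rewrite ltnNge; apply: contra (ni x y xQ yQ nxy) => le_f.
  by apply: (occurs_infix (oc _ yQ) ocx) => //; lia.
have := ovl_occurs (oc _ yQ) ocx _ lt_f => /(_ ltac:(lia)) ovyx.
exists ((y, x) :: conseq x Q'); last first.
  by rewrite [X in _ <= _ + X]big_cons /=; clear - h ovyx; lia.
have Ex : perm_eq (y :: belast x Q') (x :: Q').
  by rewrite (lastI x Q') perm_sym perm_rcons.
split; rewrite /= ?e1 ?e2.
- by rewrite -[_ && _]/(uniq (y :: belast x Q')) (perm_uniq Ex).
- by [].
- by move=> z; rewrite (perm_mem Ex) memQ.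
- by move=> z; rewrite memQ.
Qed.

End Matching.
End Occurrences.

(** * Bad intervals and culprits on the greedy path *)

Section Culprits.
Variables (N : nat) (o : nat -> nat -> nat) (E : nat -> nat).
Hypothesis monge : forall u v u' v', o u v' <= o u v -> o u' v <= o u v ->
  o u v' + o u' v <= o u v + o u' v'.
Hypotheses (E0 : E 0 = 0) (EN : E N = 0).
Hypothesis EE : forall k, 0 < k < N -> E k = o k.-1 k.
(* What the greedy rule says of a path 0, ..., N-1 of selected edges: (i, j) was
   discarded because of an edge leaving i, entering j, or leading from j to i. *)
Hypothesis greedy : forall i j, i < N -> j < N ->
  [\/ o i j <= E i.+1, o i j <= E j |
      j <= i /\ forall k, j < k <= i -> o i j <= E k].

Definition bad j i := [&& j <= i, i < N, E i.+1 < o i j & E j < o i j].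

Lemma bad_in j i k : bad j i -> j < k <= i -> o i j <= E k.
Proof.
case/and4P => le_ji lt_i h1 h2; have [h|h|[_ h]] := greedy lt_i (leq_ltn_trans le_ji lt_i).
- by rewrite ltnNge h in h1.
- by rewrite ltnNge h in h2.
- exact: h.
Qed.

(** A crossing would give [o i j <= E j' < o i' j' <= E i.+1 < o i j]. *)
Lemma bad_cross j i j' i' : bad j i -> bad j' i' -> j < j' -> j' <= i -> i' <= i.
Proof.
move=> b b' lt_j le_j; rewrite leqNgt; apply/negP => lt_i.
have h1 := bad_in (k := j') b; rewrite lt_j le_j in h1.
have h2 := bad_in (k := i.+1) b'; rewrite lt_i ltnS le_j in h2.
by case/and4P: b b' => _ _ a1 a2 /and4P[_ _ a3 a4]; have := h1 isT; have := h2 isT; lia.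
Qed.

Definition culprit (c : nat * nat) := bad c.1 c.2 &&
  `[< forall j i, c.1 <= j -> i <= c.2 -> bad j i -> j = c.1 /\ i = c.2 >].

Definition culprits := [seq c <- [seq (j, i) | j <- iota 0 N, i <- iota 0 N] | culprit c].

Lemma culpritsE c : (c \in culprits) = culprit c.
Proof.
rewrite mem_filter andb_idr // => /andP[/and4P[le_c lt_c _ _] _]; case: c le_c lt_c => j i /= h1 h2.
by apply/allpairsP; exists (j, i); rewrite !mem_iota; split=> //=; clear - h1 h2; lia.
Qed.

Lemma culprits_uniq : uniq culprits.
Proof.
by apply: filter_uniq; apply: allpairs_uniq; rewrite ?iota_uniq // => -[a b] [a' b'] _ _ [-> ->].
Qed.

Lemma culprit_bad c : culprit c -> bad c.1 c.2. Proof. by case/andP. Qed.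

Lemma culprit_min c j i : culprit c -> c.1 <= j -> i <= c.2 -> bad j i -> j = c.1 /\ i = c.2.
Proof. by case/andP => _ /asboolP; apply. Qed.

Lemma culprit_ex j i : bad j i -> exists c, [/\ culprit c, j <= c.1 & c.2 <= i].
Proof.
have [n] := ubnP (i - j); elim: n i j => // n IHn i j le_n b.
have [cu|] := boolP (culprit (j, i)); first by exists (j, i).
rewrite negb_and b /= => /asboolPn; rewrite -existsNE => -[j'].
rewrite -existsNE => -[i'] /not_implyP[le_j /not_implyP[le_i /not_implyP[b' ne]]].
have [|c [cc h1 h2]] := IHn i' j' _ b'; last by exists c; split=> //; lia.
by case/and4P: b' => h _ _ _; case/and4P: b => h' _ _ _; lia.
Qed.

(** A bad interval that starts before the culprit contains the link entering it, which weighs less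
    than the closing overlap. *)
Lemma bad_last j i c : bad j i -> culprit c -> c.1 <= i <= c.2 -> i = c.2 /\ o i j <= o c.2 c.1.
Proof.
move=> b cc /andP[h1 h2]; have bc := culprit_bad cc.
have [le_j|lt_j] := leqP c.1 j.
  by have [-> ->] := culprit_min cc le_j h2 b.
have le_i := bad_cross b bc lt_j h1.
have {le_i}ei : i = c.2 by lia.
split=> //; have := @bad_in _ _ c.1 b; rewrite lt_j h1 => /(_ isT) h.
by case/and4P: bc => _ _ _; lia.
Qed.

Lemma bad_first j i c : bad j i -> culprit c -> c.1 <= j <= c.2 -> j = c.1 /\ o i j <= o c.2 c.1.
Proof.
move=> b cc /andP[h1 h2]; have bc := culprit_bad cc.
have [le_i|lt_i] := leqP i c.2.
  by have [-> ->] := culprit_min cc h1 le_i b.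
have ej : j = c.1.
  apply/eqP; rewrite eqn_leq h1 andbT leqNgt; apply/negP => lt_j.
  by have := bad_cross bc b lt_j h2; lia.
split=> //; have := @bad_in _ _ c.2.+1 b; rewrite lt_i ltnS h2 => /(_ isT) h.
by case/and4P: bc => _ _; lia.
Qed.

Lemma culprit_disjoint c c' k : culprit c -> culprit c' ->
  c.1 <= k <= c.2 -> c'.1 <= k <= c'.2 -> c = c'.
Proof.
move=> cc cc' /andP[h1 h2] /andP[h1' h2'].
have bc := culprit_bad cc; have bc' := culprit_bad cc'.
have w c1 c2 : culprit c1 -> culprit c2 -> c1.1 <= k <= c1.2 -> c2.1 <= k <= c2.2 ->
    c1.2 <= c2.2 -> c1 = c2.
  move=> k1 k2 /andP[a1 a2] /andP[a3 a4] le2.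
  have [le1|lt1] := leqP c2.1 c1.1.
    have [] := culprit_min k2 le1 le2 (culprit_bad k1).
    by case: c1 c2 {k1 k2 a1 a2 a3 a4 le2 le1} => [? ?] [? ?] /= -> ->.
  have le3 := bad_cross (culprit_bad k1) (culprit_bad k2) lt1 (leq_trans a3 a2).
  have [] := culprit_min k1 (ltnW lt1) le3 (culprit_bad k2).
  by case: c1 c2 {k1 k2 a1 a2 a3 a4 le2 lt1 le3} => [? ?] [? ?] /= -> ->.
have [le_c|lt_c] := leqP c.2 c'.2; first by apply: w; rewrite ?h1 ?h1'.
by apply/esym; apply: w; rewrite ?h1 ?h1' // ltnW.
Qed.

Definition inside (c : nat * nat) k := c.1 <= k <= c.2.
Definition inner (c : nat * nat) k := c.1 < k <= c.2.
Definition closing (c : nat * nat) := o c.2 c.1.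

Definition cost c := \sum_(c.1.+1 <= k < c.2.+1) E k + closing c.

Lemma closing_gt c : culprit c -> E c.2.+1 < closing c /\ E c.1 < closing c.
Proof. by case/culprit_bad/and4P. Qed.

(** The objects are the edges of the closed culprit cycles. Links leaving or entering a culprit
    weigh less than its closing edge, so that edge dominates in their place; bad pairs are handled
    by [bad_last]. *)
Lemma cost_bound (cs M : seq (nat * nat)) : {subset cs <= culprits} ->
  uniq (unzip1 M) -> uniq (unzip2 M) ->
  {in unzip1 M, forall k, has (inside^~ k) cs} ->
  {in unzip2 M, forall k, has (inside^~ k) cs} ->
  \sum_(p <- M) o p.1 p.2 <= \sum_(c <- cs) cost c.
Proof.
move=> sub u1 u2 m1 m2.
pose os := [seq (Some k.-1, Some k, E k) | c <- cs, k <- index_iota c.1.+1 c.2.+1] ++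
  [seq (Some c.2, Some c.1, closing c) | c : nat * nat <- cs].
have -> : \sum_(c <- cs) cost c = \sum_(x <- os) x.2.
  by rewrite big_cat big_allpairs_dep big_map /= -big_split.
have csP (c : nat * nat) : c \in cs -> culprit c by move/sub; rewrite culpritsE.
have lt_cN (c : nat * nat) : c \in cs -> c.2 < N by move/csP/culprit_bad/and4P => [].
apply: (greedy_bound (al := fun _ _ => true)) => //.
- move=> t h w; rewrite mem_cat => /orP[/allpairsPdep[c [k [cin]]]|/mapP[c cin [-> -> ->]]] //.
  rewrite mem_index_iota => kc [-> -> ->]; split=> //; rewrite EE //.
  case/andP: kc => h1 h2; rewrite (leq_ltn_trans _ (lt_cN _ cin)) ?andbT //.
  exact: leq_ltn_trans h1.
- exact: all_predT.
move=> i j /m1/hasP[[a b] cin ci] /m2/hasP[[a' b'] c'in cj] _ oij.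
rewrite /inside /= in ci cj.
have /= lt_c := lt_cN _ cin; have /= lt_c' := lt_cN _ c'in.
have inos k d : d \in cs -> inner d k -> (Some k.-1, Some k, E k) \in os.
  move=> din dk; rewrite mem_cat; apply/orP; left; apply/allpairsPdep; exists d, k.
  by rewrite mem_index_iota.
have closs d : d \in cs -> (Some d.2, Some d.1, closing d) \in os.
  by move=> din; rewrite mem_cat; apply/orP; right; apply/mapP; exists d.
have lt_i : i < N by clear - ci lt_c; lia.
have lt_j : j < N by clear - cj lt_c'; lia.
have [le_E|lt_E] := leqP (o i j) (E i.+1).
  have [ni|le_c] := ltnP i b; last first.
    have ei : i = b by clear - ci le_c; lia.
    exists (Some b, Some a, closing (a, b)); first exact: (closs _ cin).
    have [/ltnW h _] := closing_gt (csP _ cin).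
    by rewrite ei /= eqxx /= -ei (leq_trans le_E) // ei.
  exists (Some i, Some i.+1, E i.+1); last by rewrite eqxx.
  by apply: (inos i.+1 _ cin); rewrite /inner /=; clear - ni ci; lia.
have [le_E|lt_E'] := leqP (o i j) (E j).
  have [nj|le_c] := ltnP a' j; last first.
    have ej : j = a' by clear - cj le_c; lia.
    exists (Some b', Some a', closing (a', b')); first exact: (closs _ c'in).
    have [_ /ltnW h] := closing_gt (csP _ c'in).
    by rewrite ej /= eqxx orbT /= -ej (leq_trans le_E) // ej.
  exists (Some j.-1, Some j, E j); last by rewrite eqxx orbT.
  by apply: (inos j _ c'in); rewrite /inner /=; clear - nj cj; lia.
have bji : bad j i.
  have [h|h|[le_ji _]] := greedy lt_i lt_j.
  - by rewrite ltnNge h in lt_E.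
  - by rewrite ltnNge h in lt_E'.
  - by rewrite /bad le_ji lt_i lt_E lt_E'.
exists (Some b, Some a, closing (a, b)); first exact: (closs _ cin).
by have [-> le_o] := bad_last bji (csP _ cin) ci; rewrite /= eqxx.
Qed.

Definition mid k := has (inside^~ k) culprits.

(* Outside the culprits, k is low when the least of the links that join k to its
   neighbours without crossing a culprit can be found to the left of k. *)
Definition low k := ~~ mid k && `[< exists k0, [/\ k0 <= k,
  forall t, k0 <= t <= k -> ~~ mid t &
  forall m, k < m <= N -> (forall t, k < t < m -> ~~ mid t) -> E k0 <= E m] >].

Lemma lowP k : reflect (~~ mid k /\ exists k0, [/\ k0 <= k,
  forall t, k0 <= t <= k -> ~~ mid t &
  forall m, k < m <= N -> (forall t, k < t < m -> ~~ mid t) -> E k0 <= E m]) (low k).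
Proof. by apply: (iffP andP) => -[h1 /asboolP]. Qed.

Lemma bad_mid j i : bad j i -> exists2 t, j <= t <= i & mid t.
Proof.
move=> /culprit_ex[[a b] [cc /= h1 h2]]; exists a.
  by case/and4P: (culprit_bad cc) => /= *; lia.
apply/hasP; exists (a, b); first by rewrite culpritsE.
by rewrite /inside /= leqnn; case/and4P: (culprit_bad cc).
Qed.

(** A bad interval contains a culprit, hence starts to the left of [k0], and then
    [o i j <= E k0 <= E i.+1]. *)
Lemma low_bad j i : low i -> bad j i -> False.
Proof.
case/lowP => _ [k0 [le_k nm h]] b; have [le_ji lt_i a1 a2] := and4P b.
have [le_k0|lt_k0] := leqP k0 j.
  have [t ht mt] := bad_mid b; have := nm t; rewrite mt => /(_ _)/negP; apply=> //.
  by clear - le_k0 ht; lia.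
have := bad_in b (k := k0); rewrite lt_k0 le_k => /(_ isT) h1.
have := h i.+1; rewrite ltnSn lt_i => /(_ isT) h2.
have {}h2 : E k0 <= E i.+1 by apply: h2 => t; clear; lia.
by clear - h1 h2 a1; lia.
Qed.

Lemma high_bad j i : ~~ mid j -> ~~ low j -> bad j i -> False.
Proof.
move=> mj /lowP nl b; have [le_ji lt_i a1 a2] := and4P b; apply: nl; split=> //.
(* With [k0 = j]: a lighter link to the right, within the bad interval, would contradict [bad_in],
   and one beyond it would lie past a culprit. *)
exists j; split=> // [t /anti_leq <- //|m /andP[lt_m le_m] nm].
rewrite leqNgt; apply/negP => lt_E; have [le_mi|lt_im] := leqP m i.
  by have := bad_in b (k := m); rewrite lt_m le_mi => /(_ isT); clear - lt_E a2; lia.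
have [t /andP[h1 h2] mt] := bad_mid b.
have [et|nt] := eqVneq t j; first by rewrite -et mt in mj.
by have := nm t; rewrite mt ltn_neqAle eq_sym nt h1 (leq_ltn_trans h2) // => /(_ isT).
Qed.

(** Labels thus never increase along a link outside the culprits, which is the exchange condition of
    [greedy_bound] for [link_object]. *)
Lemma low_succ i : low i -> ~~ mid i.+1 -> low i.+1.
Proof.
case/lowP => mi [k0 [le_k nm h]] mi'; apply/lowP; split=> //; exists k0; split=> //.
- exact: leqW.
- move=> t /andP[h1]; rewrite leq_eqVlt => /predU1P[-> //|h2].
  by apply: nm; rewrite h1.
- move=> m /andP[h1 h2] h3; apply: h; first by rewrite h2 ltnW.
  move=> t /andP[h4 h5]; have [->//|nt] := eqVneq t i.+1.
  by apply: h3; rewrite ltn_neqAle eq_sym nt h4.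
Qed.

(* Each string outside the culprits lives in only one of the two copies of the
   path, labelled by false and true; the strings of culprits live in both. *)
Definition slot i := if mid i then None else Some (i, ~~ low i).
Definition link_object k :=
  if has (inner^~ k) culprits then (Some (k.-1, false), Some (k, false), E k)
  else (slot k.-1, slot k, E k).

(** Both matchings are treated as one matching on the two copies, so that a link outside the
    culprits is paid for only once. Edges from the copy true to the copy false are forbidden. *)
Lemma two_matchings (M1 M2 : seq (nat * nat)) :
  uniq (unzip1 M1) -> uniq (unzip2 M1) -> uniq (unzip1 M2) -> uniq (unzip2 M2) ->
  {in unzip1 M1, forall k, k < N /\ mid k || low k} ->
  {in unzip2 M1, forall k, k < N /\ mid k || low k} ->
  {in unzip1 M2, forall k, k < N /\ ~~ low k} ->
  {in unzip2 M2, forall k, k < N /\ ~~ low k} ->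
  \sum_(p <- M1) o p.1 p.2 + \sum_(p <- M2) o p.1 p.2 <=
  \sum_(1 <= k < N) E k + \sum_(c <- culprits) (cost c + closing c).
Proof.
move=> u11 u12 u21 u22 m11 m12 m21 m22.
pose tag (b : bool) (p : nat * nat) := ((p.1, b), (p.2, b)).
pose M := map (tag false) M1 ++ map (tag true) M2.
pose os := [seq link_object k | k <- index_iota 1 N] ++
  ([seq (Some (k.-1, true), Some (k, true), E k) | c <- culprits,
     k <- index_iota c.1.+1 c.2.+1] ++
  ([seq (Some (c.2, true), Some (c.1, true), closing c) | c : nat * nat <- culprits] ++
   [seq (Some (c.2, false), Some (c.1, false), closing c) | c : nat * nat <- culprits])).
have -> : \sum_(p <- M1) o p.1 p.2 + \sum_(p <- M2) o p.1 p.2 =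
    \sum_(p <- M) o p.1.1 p.2.1 by rewrite big_cat !big_map.
have -> : \sum_(1 <= k < N) E k + \sum_(c <- culprits) (cost c + closing c) =
    \sum_(x <- os) x.2.
  rewrite !big_cat big_allpairs_dep !big_map /= big_split /cost big_split /= !addnA.
  by congr (_ + _ + _ + _); apply: eq_bigr => k _; rewrite /link_object; case: ifP.
have csP (c : nat * nat) : c \in culprits -> culprit c by rewrite culpritsE.
have lt_cN (c : nat * nat) : c \in culprits -> c.2 < N by move/csP/culprit_bad/and4P => [].
have link_in k : 0 < k < N -> link_object k \in os.
  by move=> hk; rewrite mem_cat map_f // mem_index_iota.
have tagU (M' : seq (nat * nat)) b : unzip1 (map (tag b) M') = [seq (i, b) | i <- unzip1 M'] /\
    unzip2 (map (tag b) M') = [seq (i, b) | i <- unzip2 M'].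
  by rewrite /unzip1 /unzip2 -!map_comp.
have M1E : unzip1 M = [seq (i, false) | i <- unzip1 M1] ++ [seq (i, true) | i <- unzip1 M2].
  by rewrite /unzip1 map_cat -!/(unzip1 _) !(tagU _ _).1.
have M2E : unzip2 M = [seq (i, false) | i <- unzip2 M1] ++ [seq (i, true) | i <- unzip2 M2].
  by rewrite /unzip2 map_cat -!/(unzip2 _) !(tagU _ _).2.
have uM (s1 s2 : seq nat) : uniq s1 -> uniq s2 ->
    uniq ([seq (i, false) | i <- s1] ++ [seq (i, true) | i <- s2]).
  move=> us1 us2; rewrite cat_uniq !map_inj_uniq ?us1 ?us2 ?andbT /=; try by move=> ? ? [].
  by apply/hasPn => _ /mapP[i _ ->]; apply/mapP => -[].
apply: (greedy_bound (al := fun u v : nat * bool => u.2 <= v.2)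
  (wt := fun u v : nat * bool => o u.1 v.1)).
- by move=> u v u' v'; apply: monge.
- move=> t h w hin; suff [-> le_ht] : o t.1 h.1 = w /\ h.2 <= t.2.
    by split=> // u v h1 h2; apply: leq_trans h2 (leq_trans le_ht h1).
  move: hin; rewrite !mem_cat => /orP[/mapP[k]|].
    rewrite mem_index_iota => lt_k; rewrite /link_object.
    case: ifP => _ [e1 e2 ->]; first by rewrite e1 e2 EE.
    move: e1 e2; rewrite /slot; case: ifP => // mk' [->]; case: ifP => // mk [->].
    rewrite EE //=; split=> //; case: (boolP (low k.-1)) => [lk|_]; last by case: low.
    by have := low_succ lk; case/andP: lt_k => k0 _; rewrite (prednK k0) mk => /(_ isT) ->.
  case/orP=> [/allpairsPdep[c [k [cin]]]|].
    rewrite mem_index_iota => /andP[h1 h2] [-> -> ->]; split=> //=.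
    by rewrite EE // (leq_ltn_trans _ (lt_cN _ cin)) // (leq_ltn_trans _ h1).
  by case/orP=> /mapP[c cin [-> -> ->]].
- by rewrite M1E uM.
- by rewrite M2E uM.
- by rewrite all_cat !all_map; apply/andP; split; apply/allP.
have node (s1 s2 : seq nat) : {in s1, forall k, k < N /\ mid k || low k} ->
    {in s2, forall k, k < N /\ ~~ low k} ->
    {in [seq (i, false) | i <- s1] ++ [seq (i, true) | i <- s2], forall u : nat * bool,
      u.1 < N /\ (~~ mid u.1 -> u.2 = ~~ low u.1)}.
  move=> h1 h2 u; rewrite mem_cat => /orP[]/mapP[k kin ->] /=.
    by have [lt_k mk] := h1 _ kin; split=> // nm; move: mk; rewrite (negbTE nm) => /= ->.
  by have [lt_k ->] := h2 _ kin.
rewrite M1E M2E => -[i x] [j y] /(node _ _ m11 m21)[/= lt_i ix] /(node _ _ m12 m22)[/= lt_j jy].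
move=> le_xy o_gt0.
have closs c b : c \in culprits -> (Some (c.2, b), Some (c.1, b), closing c) \in os.
  move=> cin; rewrite !mem_cat orbC -!orbA.
  by case: b; rewrite map_f ?orbT // (map_f (fun c => (Some (c.2, true), _, _))) ?orbT.
have inners c k b : c \in culprits -> inner c k -> (Some (k.-1, b), Some (k, b), E k) \in os.
  move=> cin ck; case: b.
    rewrite !mem_cat; apply/orP; right; apply/orP; left; apply/allpairsPdep; exists c, k.
    by rewrite mem_index_iota.
  have := @link_in k; rewrite /link_object ifT; last by apply/hasP; exists c.
  by apply; move: ck; rewrite /inner; have := lt_cN _ cin; case: c {cin} => a b /=; clear; lia.
have [le_E|lt_E] := leqP (o i j) (E i.+1).
  have [mi|nmi] := boolP (mid i).
    have /hasP[[a b] cin /andP[/= h1 h2]] := mi.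
    have [lt_ib|le_bi] := ltnP i b.
      exists (Some (i.+1.-1, x), Some (i.+1, x), E i.+1); last by rewrite /= eqxx.
      by apply: (inners _ _ _ cin); rewrite /inner /= ltnS h1.
    have ei : i = b by apply/eqP; rewrite eqn_leq h2.
    exists (Some (b, x), Some (a, x), closing (a, b)); first exact: (closs _ x cin).
    have [/ltnW h _] := closing_gt (csP _ cin).
    by rewrite /= ei eqxx /= -ei (leq_trans le_E) // ei.
  exists (link_object i.+1).
    apply: link_in; rewrite /= ltn_neqAle lt_i andbT.
    by apply: contraTneq (leq_trans o_gt0 le_E) => ->; rewrite EN.
  rewrite /link_object ifF /slot /= ?(negbTE nmi) -?ix ?eqxx //.
  apply: contraNF nmi => /hasP[c cin /andP[h1 h2]]; apply/hasP; exists c => //.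
  by rewrite /inside -ltnS h1 ltnW.
have [le_E|lt_E'] := leqP (o i j) (E j).
  have [mj|nmj] := boolP (mid j).
    have /hasP[[a b] cin /andP[/= h1 h2]] := mj.
    have [lt_aj|le_ja] := ltnP a j.
      exists (Some (j.-1, y), Some (j, y), E j); last by rewrite /= eqxx orbT.
      by apply: (inners _ _ _ cin); rewrite /inner /= lt_aj.
    have ej : j = a by apply/eqP; rewrite eqn_leq h1 le_ja.
    exists (Some (b, y), Some (a, y), closing (a, b)); first exact: (closs _ y cin).
    have [_ /ltnW h] := closing_gt (csP _ cin).
    by rewrite /= ej eqxx orbT /= -ej (leq_trans le_E) // ej.
  exists (link_object j).
    apply: link_in; rewrite lt_j andbT lt0n.
    by apply: contraTneq (leq_trans o_gt0 le_E) => ->; rewrite E0.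
  rewrite /link_object ifF /slot /= ?(negbTE nmj) -?jy ?eqxx ?orbT //.
  apply: contraNF nmj => /hasP[c cin /andP[h1 h2]]; apply/hasP; exists c => //.
  by rewrite /inside h2 ltnW.
have bji : bad j i.
  have [h|h|[le_ji _]] := greedy lt_i lt_j.
  - by rewrite ltnNge h in lt_E.
  - by rewrite ltnNge h in lt_E'.
  - by rewrite /bad le_ji lt_i lt_E lt_E'.
have [mi|nmi] := boolP (mid i).
  have /hasP[c cin ci] := mi.
  exists (Some (c.2, x), Some (c.1, x), closing c); first exact: closs.
  by have [-> le_o] := bad_last bji (csP _ cin) ci; rewrite /= eqxx.
(* By [low_bad] the end [i] is in the copy true; the order on labels forces [j] into the same copy,
   where [high_bad] applies. *)
have {}ix := ix nmi; case: (boolP (low i)) ix => [/low_bad/(_ bji) //|_] xt.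
have {}yt : y by rewrite xt in le_xy; case: (y) le_xy.
have [mj|nmj] := boolP (mid j).
  have /hasP[c cin cj] := mj.
  exists (Some (c.2, y), Some (c.1, y), closing c); first exact: closs.
  by have [-> le_o] := bad_first bji (csP _ cin) cj; rewrite /= eqxx orbT.
by rewrite jy // in yt; case: (high_bad nmj yt bji).
Qed.

End Culprits.

(** * The periodic word of a culprit *)

Section Merge.
Variables (T : eqType) (x0 : T) (s : nat -> seq T) (e : nat -> nat) (L oc : nat).
Hypothesis ov : forall j, j < L -> drop (size (s j) - e j) (s j) = take (e j) (s j.+1).
Hypothesis e_lt : forall j, j < L -> e j < size (s j) /\ e j < size (s j.+1).
Hypothesis border : drop (size (s L) - oc) (s L) = take oc (s 0).
Hypothesis oc_lt : oc < size (s L) /\ oc < size (s 0).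
Hypothesis oc_le : forall j, j < L -> oc <= e j.

Fixpoint merged j := if j is j'.+1 then merged j' ++ drop (e j') (s j) else s 0.
Fixpoint offset j := if j is j'.+1 then offset j' + (size (s j') - e j') else 0.

Lemma size_merged j : j <= L -> size (merged j) = offset j + size (s j).
Proof.
elim: j => [|j IHj] //= lt_j; rewrite size_cat size_drop IHj ?(ltnW lt_j) //.
by have := e_lt lt_j; lia.
Qed.

Lemma drop_merged j : j <= L -> drop (offset j) (merged j) = s j.
Proof.
elim: j => [|j IHj] lt_j; first exact: drop0.
have [h1 h2] := e_lt lt_j; have sz := size_merged (ltnW lt_j).
rewrite /= drop_cat; case: ltnP => [_|h].
  by rewrite addnC -drop_drop (IHj (ltnW lt_j)) ov // cat_take_drop.
have e0 : e j = 0 by rewrite sz in h; lia.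
by rewrite e0 drop0 sz subn0 subnn drop0.
Qed.

Lemma nth_merged i j k : i <= j -> k < size (merged i) -> nth x0 (merged j) k = nth x0 (merged i) k.
Proof.
elim: j => [|j IHj]; first by rewrite leqn0 => /eqP ->.
rewrite leq_eqVlt => /predU1P[-> //|]; rewrite ltnS => le_ij lt_k /=.
have pre : k < size (merged j).
  apply: leq_trans lt_k _; elim: j le_ij {IHj} => [|j IHj]; first by rewrite leqn0 => /eqP ->.
  by rewrite leq_eqVlt => /predU1P[-> //|/IHj h]; rewrite /= size_cat (leq_trans h) ?leq_addr.
by rewrite nth_cat pre IHj.
Qed.

Lemma merged_occurs j : j <= L -> occurs x0 (nth x0 (merged L)) (offset j) (s j).
Proof.
move=> le_j k lt_k; rewrite (nth_merged le_j) ?size_merged ?ltn_add2l //.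
by rewrite -nth_drop drop_merged.
Qed.

(* The merged word has a border of length oc, hence this period. *)
Definition perlen := offset L + size (s L) - oc.
Definition cyc u := nth x0 (merged L) (u %% perlen).

Lemma perlen_gt0 : 0 < perlen.
Proof. by rewrite /perlen; have := oc_lt; lia. Qed.

Lemma cycP k : k < size (merged L) -> nth x0 (merged L) k = cyc k.
Proof.
rewrite /cyc; have := perlen_gt0; have := size_merged (leqnn L).
move: k; apply: ltn_ind => k IHk sz p0 lt_k.
have [lt_p|le_p] := ltnP k perlen; first by rewrite modn_small.
have -> : k = (k - perlen) + perlen by rewrite subnK.
rewrite modnDr -IHk //; [|by lia|by lia].
have lt_oc : k - perlen < oc by move: lt_k le_p; rewrite sz /perlen; clear; lia.
have [h1 h2] := oc_lt.
have e1 : (offset L + (size (s L) - oc)) = perlen by rewrite /perlen; lia.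
have := congr1 (nth x0 ^~ (k - perlen)) border.
rewrite nth_drop nth_take // (merged_occurs (leqnn L)); last by lia.
rewrite addnA e1 addnC => ->.
by rewrite (nth_merged (leq0n L)) //=; apply: ltn_trans lt_oc h2.
Qed.

Lemma cyc_per u : cyc (u + perlen) = cyc u.
Proof. by rewrite /cyc modnDr. Qed.

Lemma cyc_occurs j : j <= L -> occurs x0 cyc (offset j) (s j).
Proof.
move=> le_j k lt_k; rewrite (merged_occurs le_j lt_k) cycP //.
suff : offset j + size (s j) <= size (merged L) by lia.
rewrite size_merged //; elim: (L) le_j e_lt => [|l IHl]; first by rewrite leqn0 => /eqP ->.
rewrite leq_eqVlt => /predU1P[-> //|le_j] h; have [] := h l (ltnSn l) => h1 h2.
by have := IHl le_j (fun i li => h i (ltnW li)); rewrite /=; lia.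
Qed.

(** Take the last string that starts at or before [t]: it overlaps the following one, which starts
    later, by at least [oc] letters. *)
Lemma cyc_cover t : exists j A, [/\ j <= L, offset j <= A, A + oc <= offset j + size (s j) &
  A = t %[mod perlen]].
Proof.
suff [j [A1 A2 A3]] : exists j, [/\ j <= L, offset j <= t %% perlen &
    t %% perlen + oc <= offset j + size (s j)].
  by exists j, (t %% perlen); split; rewrite ?modn_mod.
have := ltn_pmod t perlen_gt0; move: (t %% perlen) => r lt_r.
have ex : exists j, (j <= L) && (offset j <= r) by exists 0.
have bnd j : (j <= L) && (offset j <= r) -> j <= L by case/andP.
case: (ex_maxnP ex bnd) => j /andP[le_j le_r] jmax; exists j; split=> //.
have [jL|ne_j] := eqVneq j L; first by move: lt_r; rewrite /perlen jL; clear; lia.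
have lt_j : j < L by rewrite ltn_neqAle ne_j.
have : r < offset j.+1.
  rewrite ltnNge; apply/negP => h; have := jmax j.+1; rewrite lt_j h => /(_ isT).
  by rewrite ltnn.
by have [h1 h2] := e_lt lt_j; have := oc_le lt_j; rewrite /=; lia.
Qed.

Lemma perlenE : perlen + (\sum_(0 <= j < L) e j + oc) = \sum_(0 <= j < L.+1) size (s j).
Proof.
rewrite /perlen; have [h1 _] := oc_lt.
suff h : offset L + \sum_(0 <= j < L) e j = \sum_(0 <= j < L) size (s j).
  by rewrite big_nat_recr //= -h; lia.
elim: (L) e_lt => [|l IHl] h; first by rewrite !big_geq.
have [h3 _] := h l (ltnSn l); have {}IHl := IHl (fun i li => h i (ltnW li)).
by rewrite !big_nat_recr //= -IHl; lia.
Qed.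

End Merge.

Lemma extremal_rotations (be : nat -> nat) p : 0 < p ->
  (forall t, be (t + p) = be t) -> primitive be p ->
  exists r : nat * nat, [/\ least_rot ltn be p r.1, least_rot gtn be p (r.1 + r.2) & r.2 < p].
Proof.
move=> p0 per prim.
have [|i lt_i mi] := least_rot_exists ltn_irr ltn_tr _ p0 per prim.
  by move=> a b; rewrite neq_ltn.
have [|j lt_j mj] := least_rot_exists gtn_irr gtn_tr _ p0 per prim.
  by move=> a b; rewrite neq_ltn orbC.
exists (i, (j + (p - i)) %% p); rewrite /= ltn_mod; split=> //.
apply: (least_rot_mod per) mj; rewrite modnDmr addnCA subnKC; last exact: ltnW.
by rewrite modnDr.
Qed.

(** * Culprits inside a superstring, and the resulting bound *)

Section Superstring.
Variables (T : eqType) (x0 : T) (code : T -> nat) (st : nat -> seq T) (N : nat) (w : seq T).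
Hypothesis code_inj : injective code.
Hypothesis st_gt0 : forall i, i < N -> 0 < size (st i).
Hypothesis st_infix : forall i, i < N -> infix (st i) w.
Hypothesis noninf : forall i j, i < N -> j < N -> i != j -> ~~ infix (st i) (st j).

Let o i j := ovl (st i) (st j).
Definition link k := if 0 < k < N then ovl (st k.-1) (st k) else 0.
Let E := link.

Hypothesis greedy : forall i j, i < N -> j < N ->
  [\/ o i j <= E i.+1, o i j <= E j |
      j <= i /\ forall k, j < k <= i -> o i j <= E k].

Let monge u v u' v' : o u v' <= o u v -> o u' v <= o u v ->
  o u v' + o u' v <= o u v + o u' v'.
Proof. exact: ovl_monge. Qed.

Let EE k : 0 < k < N -> E k = o k.-1 k.
Proof. by rewrite /E /link => ->. Qed.

Let E0 : E 0 = 0. Proof. by rewrite /E /link ltnn. Qed.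
Let EN : E N = 0. Proof. by rewrite /E /link ltnn andbF. Qed.

Let cs := culprits N o E.

Let csP (c : nat * nat) : c \in cs -> [/\ culprit N o E c, c.1 <= c.2 & c.2 < N].
Proof. by rewrite culpritsE => cc; case/and4P: (culprit_bad cc). Qed.

Definition nodes (c : nat * nat) := index_iota c.1 c.2.+1.

Lemma mem_nodes c k : (k \in nodes c) = inside c k.
Proof. by rewrite mem_index_iota /inside ltnS. Qed.

Let strs (c : nat * nat) j := st (c.1 + j).
Let ovs (c : nat * nat) j := E (c.1 + j).+1.
Let len (c : nat * nat) := c.2 - c.1.
Let oc := closing o.
Let W c := perlen (strs c) (ovs c) (len c) (oc c).
Let al c := cyc x0 (strs c) (ovs c) (len c) (oc c).
Let off c := offset (strs c) (ovs c).

Section OneCulprit.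
Variable c : nat * nat.
Hypothesis cin : c \in cs.

Let c_ov j : j < len c ->
  drop (size (strs c j) - ovs c j) (strs c j) = take (ovs c j) (strs c j.+1).
Proof.
have [_ h1 h2] := csP cin; rewrite /len /ovs /strs => lt_j.
by rewrite EE; [rewrite /o addnS; apply: ovlP | lia].
Qed.

Let c_lt j : j < len c -> ovs c j < size (strs c j) /\ ovs c j < size (strs c j.+1).
Proof.
have [_ h1 h2] := csP cin; rewrite /len /ovs /strs => lt_j.
by rewrite EE; [rewrite /o addnS; apply: ovl_lt; apply: st_gt0; lia | lia].
Qed.

Let lastE : strs c (len c) = st c.2.
Proof. by have [_ h1 _] := csP cin; rewrite /strs /len subnKC. Qed.

Let firstE : strs c 0 = st c.1. Proof. by rewrite /strs addn0. Qed.

Let c_border : drop (size (strs c (len c)) - oc c) (strs c (len c)) = take (oc c) (strs c 0).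
Proof. by rewrite lastE firstE; apply: ovlP. Qed.

Let c_oc : oc c < size (strs c (len c)) /\ oc c < size (strs c 0).
Proof.
have [_ h1 h2] := csP cin; rewrite lastE firstE.
by apply: ovl_lt; apply: st_gt0; rewrite // (leq_ltn_trans h1).
Qed.

Let c_oc_le j : j < len c -> oc c <= ovs c j.
Proof.
have [cc h1 h2] := csP cin; rewrite /len /ovs => lt_j.
by apply: (bad_in greedy (culprit_bad cc)); lia.
Qed.

Lemma W_gt0 : 0 < W c. Proof. exact: perlen_gt0. Qed.

Lemma al_per u : al c (u + W c) = al c u. Proof. exact: cyc_per. Qed.

Lemma al_occurs i : inside c i -> occurs x0 (al c) (off c (i - c.1)) (st i).
Proof.
move=> /andP[h1 h2]; have le_i : i - c.1 <= len c by rewrite leq_sub2r.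
have -> : st i = strs c (i - c.1) by rewrite /strs subnKC.
exact: cyc_occurs.
Qed.

Lemma al_cover t : exists i A, [/\ inside c i, off c (i - c.1) <= A,
  A + oc c <= off c (i - c.1) + size (st i) & A = t %[mod W c]].
Proof.
have [j [A [h1 h2 h3 h4]]] := cyc_cover c_lt c_oc c_oc_le t.
exists (c.1 + j), A; rewrite addKn; split=> //.
by have [_ a1 a2] := csP cin; rewrite /inside; move: h1; rewrite /len; lia.
Qed.

Lemma W_cost : W c + cost o E c = \sum_(i <- nodes c) size (st i).
Proof.
have [_ h1 h2] := csP cin; have := perlenE c_lt c_oc; rewrite -/(W c).
have -> : \sum_(0 <= j < (len c).+1) size (strs c j) = \sum_(i <- nodes c) size (st i).
  rewrite /nodes -[c.1 in RHS]add0n [in RHS]big_addn subSn //; apply: eq_bigr => j _.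
  by rewrite /strs addnC.
by move=> <-; congr (_ + (_ + _)); rewrite -[c.1.+1]add0n big_addn subSS;
  apply: eq_bigr => j _; rewrite /ovs addnS addnC.
Qed.

End OneCulprit.

Let ltN c i : c \in cs -> inside c i -> i < N.
Proof. by case/csP => _ _ lt_c /andP[_ le_i]; apply: leq_ltn_trans lt_c. Qed.

Let noninfix_lt (Q : seq nat) : {in Q, forall i, i < N} -> noninfix st Q.
Proof. by move=> h i j /h lt_i /h lt_j; apply: noninf. Qed.

Definition all_nodes (ds : seq (nat * nat)) := flatten (map nodes ds).

Lemma mem_all_nodes ds k : (k \in all_nodes ds) = has (inside^~ k) ds.
Proof.
apply/flatten_mapP/hasP => -[c cin ck]; exists c => //.
  by rewrite -mem_nodes.
by rewrite mem_nodes.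
Qed.

Lemma all_nodes_uniq ds : uniq ds -> {subset ds <= cs} -> uniq (all_nodes ds).
Proof.
elim: ds => //= c ds IHds /andP[nc uds] sub; rewrite cat_uniq iota_uniq IHds //=; last first.
  by move=> d din; apply: sub; rewrite inE din orbT.
rewrite andbT; apply/hasPn => k; rewrite -/(all_nodes ds) mem_all_nodes => /hasP[d din dk].
rewrite mem_nodes; apply: contra nc => ck.
have [cc _ _] := csP (sub c (mem_head _ _)).
have [|cd _ _] := @csP d; first by apply: sub; rewrite inE din orbT.
by rewrite (culprit_disjoint E0 EN greedy cc cd ck dk).
Qed.

Lemma size_all_nodes ds : {subset ds <= cs} ->
  \sum_(i <- all_nodes ds) size (st i) = \sum_(c <- ds) W c + \sum_(c <- ds) cost o E c.
Proof.
move=> sub; rewrite big_flatten big_map -big_split /=.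
by apply: eq_big_seq => c /sub cin; rewrite -W_cost.
Qed.

(* A matching of the strings of some culprits costs at most the weights of the
   edges on the culprit cycles, by optimality of the greedy matching. *)
Lemma W_bound ds D : {subset ds <= cs} ->
  (exists2 M, matches (all_nodes ds) M &
    \sum_(i <- all_nodes ds) size (st i) <= D + \sum_(p <- M) ovl (st p.1) (st p.2)) ->
  \sum_(c <- ds) W c <= D.
Proof.
move=> sub [M [u1 u2 s1 s2]]; rewrite size_all_nodes // => le_M.
rewrite -(leq_add2r (\sum_(c <- ds) cost o E c)) (leq_trans le_M) // leq_add2l.
by apply: (cost_bound monge E0 EN EE greedy sub u1 u2) => k;
  rewrite -mem_all_nodes; [apply: s1 | apply: s2].
Qed.

Let all_lt ds : {subset ds <= cs} -> {in all_nodes ds, forall i, i < N}.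
Proof. by move=> sub i; rewrite mem_all_nodes => /hasP[c /sub cin]; apply: ltN cin. Qed.

(** With a smaller period [d], the strings of [c] would fit a cyclic word of length [d], and
    [W_bound] would give [W c <= d]. *)
Lemma al_primitive c : c \in cs -> primitive (al c) (W c).
Proof.
move=> cin d /andP[d0 lt_d] per.
have sub : {subset [:: c] <= cs} by move=> d' /[1!inE] /eqP ->.
suff : \sum_(c' <- [:: c]) W c' <= d by rewrite big_seq1 leqNgt lt_d.
apply: W_bound => //; apply: (cycle_matching (x0 := x0) (f := al c)
    (pos := fun i => off c (i - c.1))) => //.
- by apply: all_nodes_uniq.
- by apply: noninfix_lt; apply: all_lt.
- by move=> i iin; apply: st_gt0; apply: all_lt iin.
- by move=> i; rewrite mem_all_nodes /= orbF; apply: al_occurs.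
Qed.

(** Were the words conjugate, the strings of both culprits would fit one cyclic word of length
    [W c], so that [W c + W c' <= W c]. *)
Lemma al_inequiv c c' : c \in cs -> c' \in cs -> c != c' ->
  inequiv (al c) (al c') (W c) (W c').
Proof.
move=> cin c'in ncc eW r h.
have sub : {subset [:: c; c'] <= cs} by move=> d /[!inE] /orP[] /eqP ->.
suff : \sum_(d <- [:: c; c']) W d <= W c.
  by rewrite big_cons big_seq1 -[X in _ <= X]addn0 leq_add2l leqNgt W_gt0.
apply: W_bound => //; apply: (cycle_matching (x0 := x0) (f := al c)
  (pos := fun i => if inside c i then off c (i - c.1) else off c' (i - c'.1) + r)) => //.
- exact: W_gt0.
- by move=> u; apply: al_per.
- by apply: all_nodes_uniq => //=; rewrite inE ncc.
- by apply: noninfix_lt; apply: all_lt.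
- by move=> i iin; apply: st_gt0; apply: all_lt iin.
- move=> i; rewrite mem_all_nodes /= orbF; case: ifP => [ci _|_ /= ci]; first exact: al_occurs.
  by move=> k lt_k; rewrite (al_occurs c'in ci lt_k) h addnAC.
Qed.

Let pos_ex : exists pos : nat -> nat, forall i, i < N ->
  occurs x0 (nth x0 w) (pos i) (st i) /\ pos i + size (st i) <= size w.
Proof.
apply: (functional_choice (fun i P => i < N ->
  occurs x0 (nth x0 w) P (st i) /\ P + size (st i) <= size w)) => i.
have [/st_infix/(infix_occurs x0)[P oP le_P]|_] := ltnP i N; last by exists 0.
by exists P.
Qed.

Lemma nodes_matching (Q : seq nat) : uniq Q -> {in Q, forall i, i < N} ->
  exists2 M, matches Q M & \sum_(i <- Q) size (st i) <=
    size w + \sum_(p <- M) ovl (st p.1) (st p.2).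
Proof.
move=> uQ ltQ; have [pos posP] := pos_ex.
apply: (path_matching (x0 := x0) (f := nth x0 w) (pos := pos)) => //.
- exact: noninfix_lt.
- by move=> i /ltQ /posP[].
- by move=> i /ltQ /posP[].
Qed.

Lemma W_le_superstring : \sum_(c <- cs) W c <= size w.
Proof.
have sub : {subset cs <= cs} by [].
apply: W_bound => //; apply: nodes_matching; last exact: all_lt.
by apply: all_nodes_uniq => //; apply: culprits_uniq.
Qed.

Lemma closing_bound : 26 * \sum_(c <- cs) oc c <=
  26 * size w + 37 * \sum_(c <- cs) W c.
Proof.
have [pos posP] := pos_ex.
pose cul (c : 'I_(size cs)) := nth (0, 0) cs c.
have culP c : cul c \in cs by apply: mem_nth.
have cul_inj : injective cul.
  move=> c c' /eqP; rewrite nth_uniq ?culprits_uniq // => /eqP; exact: val_inj.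
pose be c u := code (al (cul c) u).
have be_per c u : be c (u + W (cul c)) = be c u by rewrite /be al_per.
have be_prim c : primitive (be c) (W (cul c)).
  move=> d hd per; apply: (al_primitive (culP c) hd) => u.
  by apply: code_inj; apply: per.
have [r rP] : exists r : 'I_(size cs) -> nat * nat, forall c,
    [/\ least_rot ltn (be c) (W (cul c)) (r c).1,
        least_rot gtn (be c) (W (cul c)) ((r c).1 + (r c).2) & (r c).2 < W (cul c)].
  apply: (functional_choice (fun c (x : nat * nat) =>
    [/\ least_rot ltn (be c) (W (cul c)) x.1,
        least_rot gtn (be c) (W (cul c)) (x.1 + x.2) & x.2 < W (cul c)])) => c.
  by apply: extremal_rotations => //; apply: W_gt0.
have E1 (F : nat * nat -> nat) : \sum_(c <- cs) F c = \sum_(c < size cs) F (cul c).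
  by rewrite (big_nth (0, 0)) big_mkord.
(* A string is indexed together with its culprit, so that its phase is a function of the index
   alone. *)
pose mem (c : 'I_(size cs)) : pred ('I_(size cs) * nat) :=
  fun x => (x.1 == c) && inside (cul c) x.2.
have memP c x : mem c x -> x.1 = c /\ inside (cul c) x.2 by case/andP => /eqP.
have mem_lt c x : mem c x -> x.2 < N by case/memP => _; apply: ltN.
rewrite !E1.
apply: (charging (W := fun c => W (cul c)) (o := fun c => oc (cul c))
  (i0 := fun c => (r c).1) (d := fun c => (r c).2) (al := be) (mem := mem)
  (pos := fun x => pos x.2) (len := fun x => size (st x.2))
  (ph := fun x => off (cul x.1) (x.2 - (cul x.1).1))
  (T := fun u => code (nth x0 w u))) => //.
- by move=> c; apply: W_gt0.
- move=> c c' ncc e t h; apply: (@al_inequiv (cul c) (cul c') _ _ _ e t) => //.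
    by apply: contra ncc => /eqP/cul_inj ->.
  by move=> u; apply: code_inj; apply: h.
- by move=> c; case: (rP c).
- by move=> c; case: (rP c).
- by move=> c; case: (rP c).
- move=> c x k mx lt_k; have [ex ix] := memP _ _ mx; have [ox _] := posP _ (mem_lt _ _ mx).
  by rewrite -(ox k lt_k) /be ex (al_occurs (culP c) ix lt_k).
- move=> c t; have [i [A [ci A1 A2 A3]]] := al_cover (culP c) t.
  exists (c, i); split; first by rewrite /mem eqxx.
  exists (pos i + (A - off (cul c) (i - (cul c).1))); rewrite /= addKn leq_addr subnKC //.
  by split=> //; rewrite -addnA leq_add2l; lia.
- by move=> c c' x /memP[<- _] /memP[<- _].
- move=> c c' x x' mx mx' nxx le_p.
  have [ex ix] := memP _ _ mx; have [ex' ix'] := memP _ _ mx'.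
  have lt_x := mem_lt _ _ mx; have lt_x' := mem_lt _ _ mx'.
  have ni : noninfix st [:: x.2; x'.2].
    by apply: noninfix_lt => i; rewrite !inE => /orP[]/eqP->.
  apply: (occurs_lt (x0 := x0) (f := nth x0 w) ni) => //.
  + by move=> i; rewrite !inE => /orP[]/eqP->; apply: (posP _ _).1.
  + by rewrite mem_head.
  + by rewrite !inE eqxx orbT.
  apply: contra nxx => /eqP e2; apply/eqP; rewrite (surjective_pairing x) (surjective_pairing x').
  congr (_, _) => //; rewrite ex ex'; apply: cul_inj.
  have [cc _ _] := csP (culP c); have [cc' _ _] := csP (culP c').
  by apply: (culprit_disjoint E0 EN greedy cc cc' ix); rewrite e2.
- by move=> c x mx; have [] := posP _ (mem_lt _ _ mx).
Qed.

Theorem path_bound : 26 * \sum_(0 <= k < N) size (st k) <=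
  89 * size w + 26 * \sum_(1 <= k < N) link k.
Proof.
have mcs k : mid N o E k = (k \in all_nodes cs) by rewrite mem_all_nodes.
pose Q1 := [seq k <- iota 0 N | mid N o E k || low N o E k].
pose Q2 := [seq k <- iota 0 N | ~~ low N o E k].
have lt1 : {in Q1, forall i, i < N} by move=> i; rewrite mem_filter mem_iota => /andP[].
have lt2 : {in Q2, forall i, i < N} by move=> i; rewrite mem_filter mem_iota => /andP[].
have [|M1 [u11 u12 s11 s12] le1] := @nodes_matching Q1 _ lt1.
  by rewrite filter_uniq ?iota_uniq.
have [|M2 [u21 u22 s21 s22] le2] := @nodes_matching Q2 _ lt2.
  by rewrite filter_uniq ?iota_uniq.
have in1 k : k \in Q1 -> k < N /\ mid N o E k || low N o E k.
  by move=> kin; rewrite lt1 //; move: kin; rewrite mem_filter => /andP[].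
have in2 k : k \in Q2 -> k < N /\ ~~ low N o E k.
  by move=> kin; rewrite lt2 //; move: kin; rewrite mem_filter => /andP[].
have h2 : \sum_(p <- M1) o p.1 p.2 + \sum_(p <- M2) o p.1 p.2 <= \sum_(1 <= k < N) link k +
    (\sum_(c <- cs) cost o E c + \sum_(c <- cs) oc c).
  rewrite -big_split; exact: (two_matchings monge E0 EN EE greedy u11 u12 u21 u22
  (fun k h => in1 k (s11 k h)) (fun k h => in1 k (s12 k h))
  (fun k h => in2 k (s21 k h)) (fun k h => in2 k (s22 k h))).
have sub : {subset cs <= cs} by [].
have uN : uniq (all_nodes cs) by apply: all_nodes_uniq => //; apply: culprits_uniq.
have h1 : \sum_(k <- Q1) size (st k) + \sum_(k <- Q2) size (st k) =
  \sum_(0 <= k < N) size (st k) + (\sum_(c <- cs) W c + \sum_(c <- cs) cost o E c).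
  have pm : perm_eq (all_nodes cs) [seq k <- iota 0 N | mid N o E k].
    apply: uniq_perm => [|| k]; rewrite ?filter_uniq ?iota_uniq //.
    rewrite mem_filter mem_iota -mcs /= add0n andb_idr //.
    by rewrite mcs => /(all_lt sub).
  rewrite -size_all_nodes // (perm_big _ pm) !big_filter /index_iota subn0
    big_mkcond [in X in _ + X = _]big_mkcond -big_split.
  rewrite [in X in _ = _ + X]big_mkcond -big_split; apply: eq_bigr => k _ /=.
  case: (boolP (low N o E k)) => [/lowP[/negbTE -> _]|_] /=; first by rewrite addn0.
  by rewrite orbF addnC.
have leW := W_le_superstring; have leo := closing_bound.
move: h1 h2 leW leo le1 le2; rewrite -/o.
move: (\sum_(c <- cs) W c) (\sum_(c <- cs) cost o E c) (\sum_(c <- cs) oc c)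
  (\sum_(k <- Q1) _) (\sum_(k <- Q2) _) (\sum_(p <- M1) _) (\sum_(p <- M2) _)
  (\sum_(0 <= k < N) _) (\sum_(1 <= k < N) _).
by clear; lia.
Qed.

End Superstring.

(** * The output of GREEDY *)

Section LongestOverlap.
Variable A : finType.
Implicit Types s t u : seq A.

Lemma ov_suffix s t : suffix (ov s t) s.
Proof.
elim: s => [|a s IHs] /=; first by case: ifP.
case: ifP => _; first exact: suffix_refl.
exact: suffix_trans IHs (suffix_cons _ _).
Qed.

Lemma ov_prefix s t : prefix (ov s t) t.
Proof. by elim: s => [|a s IHs] /=; case: ifP => // _; rewrite prefix0s. Qed.

Lemma ov_max s t u : suffix u s -> prefix u t -> size u <= size (ov s t).
Proof.
move=> us ut; elim: s us => [|a s IHs] us /=.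
  by move: us; rewrite suffixs0 => /eqP ->.
case: ifP => [_|npre]; first by have /size_suffix := us.
case/suffixP: us => -[|b r] /= e; first by rewrite e ut in npre.
by apply: IHs; apply/suffixP; exists r; case: e.
Qed.

Lemma size_ov s t : ~~ infix s t -> ~~ infix t s -> size (ov s t) = ovl s t.
Proof.
move=> nst nts; have sf := ov_suffix s t; have pf := ov_prefix s t.
apply/eqP; rewrite eqn_leq; apply/andP; split.
  have lt_s : size (ov s t) < size s.
    rewrite ltn_neqAle size_suffix // andbT; apply: contra nst => /eqP e.
    move: sf; rewrite suffixE e subnn drop0 => /eqP es.
    by rewrite {1}es; apply: prefixW.
  have lt_t : size (ov s t) < size t.
    rewrite ltn_neqAle size_prefix // andbT; apply: contra nts => /eqP e.
    move: pf; rewrite prefixE e take_size => /eqP et.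
    by rewrite {1}et; apply: suffixW.
  apply: ovl_max => //; move: sf pf; rewrite suffixE prefixE => /eqP -> /eqP ->.
  by [].
have e := ovlP s t.
have sz : size (take (ovl s t) t) = ovl s t.
  have [->|/[dup] /ovl_gt0[s0 t0] _] := posnP (ovl s t); first by rewrite take0.
  by rewrite size_takel //; case: (ovl_lt s0 t0) => _ /ltnW.
rewrite -{1}sz; apply: ov_max; last by rewrite prefixE sz.
by rewrite -e suffix_drop.
Qed.

Lemma size_merge_from s (q : seq (seq A)) :
  size (merge_from s q) +
    \sum_(k < size q) size (ov (nth [::] (s :: q) k) (nth [::] (s :: q) k.+1)) =
  \sum_(k < (size q).+1) size (nth [::] (s :: q) k).
Proof.
elim: q s => [|t q IHq] s; first by rewrite big_ord0 big_ord1 addn0.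
have -> : \sum_(k < size (t :: q))
      size (ov (nth [::] [:: s, t & q] k) (nth [::] [:: s, t & q] k.+1)) =
    size (ov s t) + \sum_(k < size q) size (ov (nth [::] (t :: q) k) (nth [::] (t :: q) k.+1)).
  by rewrite (big_ord_recl (size q)).
have -> : \sum_(k < (size (t :: q)).+1) size (nth [::] [:: s, t & q] k) =
    size s + \sum_(k < (size q).+1) size (nth [::] (t :: q) k) by rewrite big_ord_recl.
have le_s : size (ov s t) <= size s := size_suffix (ov_suffix s t).
rewrite -IHq /= size_cat size_takel ?leq_subr // addnACA subnK //.
Qed.

Lemma size_merge_path (q : seq (seq A)) : size (Defs.merge_path q) +
    \sum_(1 <= k < size q) size (ov (nth [::] q k.-1) (nth [::] q k)) =
  \sum_(0 <= k < size q) size (nth [::] q k).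
Proof.
case: q => [|s q]; first by rewrite !big_geq.
by rewrite big_add1 /= !big_mkord size_merge_from.
Qed.

End LongestOverlap.

(** * The edges selected by GREEDY *)

Section Selection.
Variables (A : finType) (S : {fset seq A}).
Implicit Types (E F : seq (S * S)) (e f : S * S).

Lemma greedy_edges_rcons E e : greedy_edges (rcons E e) =
  if selectable (greedy_edges E) e then rcons (greedy_edges E) e else greedy_edges E.
Proof. by rewrite /greedy_edges foldl_rcons. Qed.

Lemma greedy_edges_sub E : {subset greedy_edges E <= E}.
Proof.
elim/last_ind: E => // E e IHE f; rewrite greedy_edges_rcons mem_rcons inE.
case: ifP => _; last by move/IHE => ->; rewrite orbT.
by rewrite mem_rcons inE => /predU1P[->|/IHE ->]; rewrite ?eqxx ?orbT.
Qed.

Lemma greedy_edges_cat E E' : {subset greedy_edges E <= greedy_edges (E ++ E')}.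
Proof.
elim/last_ind: E' => [|E' e IHE] f; first by rewrite cats0.
rewrite -rcons_cat greedy_edges_rcons => /IHE fE; case: ifP => // _.
by rewrite mem_rcons inE fE orbT.
Qed.

Lemma greedy_edges_inj E f f' : f \in greedy_edges E -> f' \in greedy_edges E ->
  f.1 = f'.1 \/ f.2 = f'.2 -> f = f'.
Proof.
elim/last_ind: E => // E e IHE; rewrite greedy_edges_rcons; case: ifP => // sel.
have ne h : h \in greedy_edges E -> h.1 = e.1 \/ h.2 = e.2 -> False.
  case/and3P: sel => /allP a1 /allP a2 _ hin [] /eqP eh.
    by have := a1 _ hin; rewrite eh.
  by have := a2 _ hin; rewrite eh.
rewrite !mem_rcons !inE => /predU1P[->|fin] /predU1P[->|f'in] //.
- by move=> h; case: (ne _ f'in); case: h => ->; [left | right].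
- by move/(ne _ fin).
- exact: IHE.
Qed.

Lemma connect_rcons F a b x y : connect (fun u v => (u, v) \in rcons F (a, b)) x y ->
  connect (fun u v => (u, v) \in F) x y \/
  connect (fun u v => (u, v) \in F) x a /\ connect (fun u v => (u, v) \in F) b y.
Proof.
case/connectP => q; elim: q x => [|z q IHq] x /=; first by move=> _ ->; left.
rewrite mem_rcons inE => /andP[/predU1P[[-> ->]|xz] /IHq h] /h{h}[zy|[za bY]].
- by right.
- by right.
- by left; apply: connect_trans zy; apply: connect1.
- by right; split=> //; apply: connect_trans za; apply: connect1.
Qed.

Lemma greedy_edges_acyclic E u v : (u, v) \in greedy_edges E ->
  ~~ connect (fun x y => (x, y) \in greedy_edges E) v u.
Proof.
elim/last_ind: E u v => // E [a b] IHE u v; rewrite greedy_edges_rcons.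
case: ifP => [/and3P[_ _ /= nba]|_]; last exact: IHE.
rewrite mem_rcons inE => /predU1P[[-> ->]|uv]; apply/negP => /connect_rcons[].
- by apply/negP.
- by case; rewrite (negbTE nba).
- by apply/negP; apply: IHE.
- case=> va bu; case/negP: nba; apply: connect_trans bu _; apply: connect_trans va.
  exact: connect1.
Qed.

(** [F] is the selection at the moment [e] is examined; its edges precede [e] in the sorted list. *)
Lemma greedy_choice E e :
  sorted (fun e f : S * S =>
            size (ov (val f.1) (val f.2)) <= size (ov (val e.1) (val e.2))) E ->
  e \in E -> e \in greedy_edges E \/
  exists F, [/\ {subset F <= greedy_edges E}, ~~ selectable F e &
    {in F, forall f, size (ov (val e.1) (val e.2)) <= size (ov (val f.1) (val f.2))}].
Proof.
set le := (X in sorted X) => sE eE; have [E1 [E2 eqE]] : exists E1 E2, E = E1 ++ e :: E2.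
  by case/splitPr: eE => E1 E2; exists E1, E2.
have [sel|nsel] := boolP (selectable (greedy_edges E1) e).
  left; rewrite eqE -cat_rcons; apply: greedy_edges_cat.
  by rewrite greedy_edges_rcons sel mem_rcons mem_head.
right; exists (greedy_edges E1); split=> // [|f /greedy_edges_sub fE1].
  by rewrite eqE; apply: greedy_edges_cat.
have le_tr : transitive le by move=> x y z h1 h2; apply: leq_trans h2 h1.
suff : sorted le [:: f; e] by rewrite /= andbT.
apply: (subseq_sorted le_tr) sE; rewrite eqE -[[:: f; e]]/([:: f] ++ [:: e]).
by apply: cat_subseq; rewrite sub1seq // mem_head.
Qed.

End Selection.

Section Path.
Variables (A : finType) (S : {fset seq A}) (E : seq (S * S)) (p : seq S) (v0 : S).
Hypothesis E_order : greedy_order E.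
Hypothesis p_perm : perm_eq p (enum {: S}).
Hypothesis p_path : sorted (fun u v => (u, v) \in greedy_edges E) p.
Hypothesis noninf : forall u v : S, u != v -> ~~ infix (val u) (val v).

Let N := size p.
Let nd := nth v0 p.
Let F := greedy_edges E.

Let p_uniq : uniq p. Proof. by rewrite (perm_uniq p_perm) enum_uniq. Qed.

Let ndE i j : i < N -> j < N -> nd i = nd j -> i = j.
Proof. by move=> lt_i lt_j /eqP; rewrite nth_uniq // => /eqP. Qed.

Let nd_ex u : exists2 i, i < N & u = nd i.
Proof.
have up : u \in p by rewrite (perm_mem p_perm) mem_enum.
by exists (index u p); rewrite ?index_mem // /nd nth_index.
Qed.

Let nd_edge k : k.+1 < N -> (nd k, nd k.+1) \in F.
Proof. by move=> lt_k; have /(sortedP v0) := p_path; apply. Qed.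

Let nd_connect k : k < N -> connect (fun u v => (u, v) \in F) (nd 0) (nd k).
Proof.
elim: k => [|k IHk] lt_k; first exact: connect0.
by apply: connect_trans (IHk (ltnW lt_k)) _; apply: connect1; apply: nd_edge.
Qed.

(** An edge into the first vertex would close a cycle with the path; every other vertex already has
    its incoming edge from the path. *)
Lemma edge_consecutive u v : (u, v) \in F -> exists k, [/\ k.+1 < N, u = nd k & v = nd k.+1].
Proof.
move=> uv; have [i lt_i ui] := nd_ex u; have [[|j] lt_j vj] := nd_ex v.
  have := greedy_edges_acyclic uv; rewrite vj ui nd_connect //.
have := greedy_edges_inj uv (nd_edge lt_j) (or_intror vj) => -[uj _].
by exists j.
Qed.

Let st k := val (nd k).
Let wt (e : S * S) := size (ov (val e.1) (val e.2)).

Lemma wt_ovl (u v : S) : u != v -> wt (u, v) = ovl (val u) (val v).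
Proof. by move=> uv; apply: size_ov; apply: noninf; rewrite // eq_sym. Qed.

Let nd_neq i j : i < N -> j < N -> i != j -> nd i != nd j.
Proof. by move=> lt_i lt_j; apply: contra => /eqP /ndE ->. Qed.

Lemma link_edge k : k.+1 < N -> link st N k.+1 = wt (nd k, nd k.+1).
Proof.
move=> lt_k; rewrite /link /= lt_k wt_ovl //; apply: nd_neq => //; first exact: ltnW.
by rewrite neq_ltn ltnSn.
Qed.

Lemma path_greedy i j : i < N -> j < N ->
  [\/ ovl (st i) (st j) <= link st N i.+1, ovl (st i) (st j) <= link st N j |
      j <= i /\ forall k, j < k <= i -> ovl (st i) (st j) <= link st N k].
Proof.
move=> lt_i lt_j; have [->|nij] := eqVneq i j.
  (* The pair [(i, i)] is never examined by GREEDY; the third alternative is vacuous for it. *)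
  by apply: Or33; split=> // k; clear; lia.
have nuv := nd_neq lt_i lt_j nij; rewrite -(wt_ovl nuv).
case: E_order => pE sE; have eE : (nd i, nd j) \in E.
  by rewrite (perm_mem pE) mem_filter nuv mem_enum.
have [/edge_consecutive[k [lt_k ei ej]]|[F' [sub nsel le_F]]] := greedy_choice sE eE.
  have ik := ndE lt_i (ltnW lt_k) ei; have jk := ndE lt_j lt_k ej; rewrite ik jk.
  by apply: Or31; rewrite link_edge.
have consec f : f \in F' -> exists k, [/\ k.+1 < N, f = (nd k, nd k.+1) &
    wt (nd i, nd j) <= link st N k.+1].
  case: f => u v fF; have [k [lt_k uk vk]] := edge_consecutive (sub _ fF).
  by exists k; rewrite link_edge // -uk -vk; split=> //; apply: le_F.
move: nsel; rewrite /selectable !negb_and negbK => /or3P[/allPn[f fF]|/allPn[f fF]|].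
- rewrite negbK => /eqP; have [k [lt_k -> le_k]] := consec _ fF => /= /esym ei.
  by apply: Or31; rewrite -(ndE lt_i (ltnW lt_k) ei) in le_k.
- rewrite negbK => /eqP; have [k [lt_k -> le_k]] := consec _ fF => /= /esym ej.
  by apply: Or32; rewrite -(ndE lt_j lt_k ej) in le_k.
move=> /= /connectP[q qF iq]; apply: Or33.
move: (wt (nd i, nd j)) consec {eE nij nuv le_F} => c consec.
elim: q j lt_j qF iq => [|v q IHq] j lt_j /=.
  by move=> _ ei; rewrite (ndE lt_i lt_j ei) leqnn; split=> // k; clear; lia.
move=> /andP[jv qF] iq; have [k [lt_k [jk vk] le_k]] := consec _ jv.
have {}jk := ndE lt_j (ltnW lt_k) jk; rewrite vk -jk in qF iq; rewrite -jk in lt_k le_k.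
have [lt_ji IH] := IHq _ lt_k qF iq; split; first exact: ltnW.
move=> l /andP[]; rewrite leq_eqVlt => /predU1P[<- //|lt_l] le_l.
by apply: IH; rewrite lt_l.
Qed.

Lemma size_merge_nd : size (Defs.merge_path (map val p)) + \sum_(1 <= k < N) link st N k =
  \sum_(0 <= k < N) size (st k).
Proof.
have nthE k : k < N -> nth [::] (map val p) k = st k.
  by move=> lt_k; rewrite (nth_map v0).
have := size_merge_path (map val p); rewrite size_map -/N => h.
transitivity (\sum_(0 <= k < N) size (nth [::] (map val p) k)); last first.
  by apply: eq_big_nat => k /andP[_ lt_k]; rewrite nthE.
rewrite -h; congr (_ + _); apply: eq_big_nat => -[|k] // /andP[_ lt_k].
by rewrite link_edge // !nthE // ltnW.
Qed.

End Path.

Lemma maximal_stringsP (A : finType) (S : {fset seq A}) (s : seq A) :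
  s \in maximal_strings S -> s \in S /\ forall t, t \in S -> infix s t -> t = s.
Proof.
rewrite !inE /= => /andP[sS /allP h]; split=> // t tS st.
by have := h t tS; rewrite st => /eqP.
Qed.

Lemma greedy_ratio (A : finType) (S : {fset seq A}) (w g : seq A) :
  shortest_superstring S w -> greedy_output (maximal_strings S) g ->
  26 * size g <= 89 * size w.
Proof.
move=> [sup _] [E [p [E_order p_perm p_path ->]]].
set S' := maximal_strings S in E p E_order p_perm p_path *.
have S'P (u : S') : val u \in S /\ forall t, t \in S -> infix (val u) t -> t = val u.
  exact: maximal_stringsP (valP u).
have noninf (u v : S') : u != v -> ~~ infix (val u) (val v).
  move=> nuv; apply: contra nuv => uv; apply/eqP/val_inj/esym.
  by apply: (S'P u).2 uv; apply: (S'P v).1.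
case pE : p => [|v0 q]; first by [].
rewrite -pE; have szg := size_merge_nd v0 p_perm noninf.
(* The empty string is maximal only if there is no other string; then the output is empty. Otherwise
   a string supplies the default letter [x0]. *)
have [/hasP[u _ /eqP u0]|/hasPn nonempty] := boolP (has (fun u : S' => val u == [::]) p).
  have all0 (v : S') : val v = [::].
    by rewrite -u0; apply: (S'P u).2; [apply: (S'P v).1 | rewrite u0 infix0s].
  have : \sum_(0 <= k < size p) size (val (nth v0 p k)) = 0.
    by rewrite big1 // => k _; rewrite all0.
  by move: szg; clear; lia.
have mem_p u : u \in p by rewrite (perm_mem p_perm) mem_enum.
have [x0 _] : exists x : A, True.
  by have := nonempty v0 (mem_p v0); case: (val v0) => // x; exists x.
have code_inj : injective (fun a : A => nat_of_ord (enum_rank a)).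
  by move=> a b /val_inj /enum_rank_inj.
have h : 26 * \sum_(0 <= k < size p) size (val (nth v0 p k)) <= 89 * size w +
    26 * \sum_(1 <= k < size p) link (fun k => val (nth v0 p k)) (size p) k.
  apply: (path_bound x0 code_inj).
  - by move=> k lt_k; rewrite lt0n size_eq0; apply: nonempty; apply: mem_nth.
  - by move=> k lt_k; apply: sup; apply: (S'P _).1.
  - move=> i j lt_i lt_j nij; apply: noninf; apply: contra nij.
    by rewrite nth_uniq // (perm_uniq p_perm) enum_uniq.
  - exact: (path_greedy v0 E_order p_perm p_path noninf).
by move: szg h; clear; lia.
Qed.

Local Open Scope ring_scope.

Theorem theorem1 (R : rcfType) (A : finType) (S : {fset seq A})
    (w g : seq A) :
  shortest_superstring S w ->
  greedy_output (maximal_strings S) g ->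
  (size g)%:R <= (13 + Num.sqrt 57) / 6 * (size w)%:R :> R.
Proof.
move=> sw go; have := greedy_ratio sw go; rewrite -(ler_nat R) !natrM => le_g.
(* 98/13 = 6 * 89/26 - 13, and its square 9604/169 is less than 57. *)
have le_sqrt : 98%:R / 13%:R <= Num.sqrt 57 :> R.
  rewrite -[X in X <= _]ger0_norm ?divr_ge0 ?ler0n // -sqrtr_sqr ler_sqrt ?ler0n //.
  by lra.
have le_c : 89%:R / 26%:R <= (13 + Num.sqrt 57) / 6 :> R by lra.
apply: le_trans (_ : 89%:R / 26%:R * (size w)%:R <= _); first by lra.
by rewrite ler_wpM2r ?ler0n.
Qed.
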